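(* Let $\mathbf{y}[k]\in\mathbb{R}^n$, $k\ge0$, be a stationary process that is $L$-mixing with respect to $(\mathcal{F},\mathcal{F}^+)$, and let $1\le K\le M$ be integers. Consider the online algorithm: $\hat{\boldsymbol{\mu}}_0=0$, $\hat{\boldsymbol{\Phi}}_0(s)$ arbitrary, and for $j\ge0$, $$\hat{\boldsymbol{\mu}}_{j+1}=\hat{\boldsymbol{\mu}}_j+\alpha_j(\bar{\mathbf{y}}_j-\hat{\boldsymbol{\mu}}_j),\qquad \hat{\boldsymbol{\Phi}}_{j+1}(s)=\hat{\boldsymbol{\Phi}}_j(s)+\alpha_j\big(\Delta\hat{\mathbf{y}}_j(s)\Delta\hat{\mathbf{y}}_j(s)^\star-\hat{\boldsymbol{\Phi}}_j(s)\big),$$ with $\alpha_j=\frac{1}{j+1}$ and $\Delta\hat{\mathbf{y}}_j(s)=\hat{\mathbf{y}}_j(s)-h(s)\hat{\boldsymbol{\mu}}_j$. Then for all integers $k\ge2$, all $s\in\mathbb{R}$, and all $q\ge1$, $$\big\|\hat{\boldsymbol{\Phi}}_k(s)-\bar{\Phi}(s)\big\|_{L_q}\le b_q\frac{1}{\sqrt{k}}+\big(M_{4q}(\mathbf{y})^2+2c_{1,2q}M_{4q}(\mathbf{y})\big)\frac{M}{k},$$ where $b_q=4\sqrt{6(2q-1)c_{1,2q}^3c_{2,2q}}+6c_{1,2q}c_{2q}+2c_{2q}^2$, with $c_{1,q}=4\sqrt{(2q-1)M_{2q}(\mathbf{y})\Gamma_{d,2q}(\mathbf{y})}$, $c_{2,q}=2\big(\lfloor\frac{M-1}{K}\rfloor+1\big)c_{1,q}+\big(\lfloor\frac{M-1}{K}\rfloor+1\big)\Gamma_{d,2q}(\mathbf{y})$,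 and $c_q=c_{1,q}\big(\lfloor\frac{M-1}{K}\rfloor+1\big)$ (each evaluated with $q$ replaced by $2q$ as indicated).
   Context: Probability space with a monotone increasing family of $\sigma$-algebras $\mathcal{F}=(\mathcal{F}_k)_{k\ge0}$ and a monotone decreasing family $\mathcal{F}^+=(\mathcal{F}_k^+)_{k\ge0}$ such that $\mathcal{F}_k$ and $\mathcal{F}_k^+$ are independent for every $k$. For a random variable $\mathbf{x}$ in a finite-dimensional real or complex inner product space (Euclidean norm for vectors, Frobenius norm for matrices) and $q\ge1$, $\|\mathbf{x}\|_{L_q}=(\mathbb{E}\|\mathbf{x}\|^q)^{1/q}$. A process $(\mathbf{x}_k)_{k\ge0}$ is $L$-mixing with respect to $(\mathcal{F},\mathcal{F}^+)$ if: $\mathbf{x}_k$ is $\mathcal{F}_k$-measurable for all $k$; $M_q(\mathbf{x}):=\sup_{k\ge0}\|\mathbf{x}_k\|_{L_q}<\infty$ for all $q\ge1$; and $\Gamma_{d,q}(\mathbf{x}):=\sum_{\tau=0}^\infty\gamma_q(\tau,\mathbf{x})<\infty$ for all $q\ge1$, where $\gamma_q(\tau,\mathbf{x})=\sup_{k\ge\tau}\|\mathbf{x}_k-\mathbb{E}[\mathbf{x}_k\mid\mathcal{F}^+_{k-\tau}]\|_{L_q}$. Setup: $\mathbf{y}[k]\in\mathbb{R}^n$ is stationary with mean $\mu=\mathbb{E}[\mathbf{y}[k]]$. Fix integers $1\le K\le M$ and, for each $s\in\mathbb{R}$, complex weights $w_0(s),\dots,w_{M-1}(s)$ with $\sum_{k=0}^{M-1}|w_k(s)|^2=1$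 (e.g. Bartlett: $K=M$, $w_k(s)=M^{-1/2}e^{-j2\pi ks}$; Welch: $w_k(s)=\frac{v_k}{\|v\|_2}e^{-j2\pi ks}$ for a fixed nonzero $v\in\mathbb{R}^M$). Define for $i\ge0$: $\bar{\mathbf{y}}_i=\frac1M\sum_{k=0}^{M-1}\mathbf{y}[iK+k]$, $\hat{\mathbf{y}}_i(s)=\sum_{k=0}^{M-1}w_k(s)\mathbf{y}[iK+k]$, $h(s)=\sum_{k=0}^{M-1}w_k(s)$, and $\bar{\Phi}(s)=\mathbb{E}\big[(\hat{\mathbf{y}}_i(s)-h(s)\mu)(\hat{\mathbf{y}}_i(s)-h(s)\mu)^\star\big]$ (independent of $i$ by stationarity); $\star$ denotes conjugate transpose. *)

(* Defs.v *)
(* mathcomp-analysis (measure/probability) + real_closed complex R[i]. *)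
From HB Require Import structures.
From mathcomp Require Import all_boot all_order all_algebra.
From mathcomp Require Import all_classical all_reals all_analysis.
From mathcomp Require Import complex.
Set Implicit Arguments. Unset Strict Implicit. Unset Printing Implicit Defensive.
Import Order.TTheory GRing.Theory Num.Theory.
Local Open Scope classical_set_scope.
Local Open Scope ring_scope.

Section Defs.
Context {R : realType} {d : measure_display} {T : measurableType d}.
Variable P : probability T R.

(* ---------- sigma-algebras, measurability, independence ---------- *)
(* G is a sub-sigma-algebra of the ambient sigma-algebra on T *)
Definition sub_sigma (G : set (set T)) :=
  sigma_algebra setT G /\ G `<=` measurable.

(* f : T -> R is G-measurable *)
Definition Gmeasurable (G : set (set T)) (f : T -> R) :=
  forall B : set R, measurable B -> G (f @^-1` B).

(* independence of two sigma-algebras *)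
Definition indep_sigma (G H : set (set T)) :=
  forall A B, G A -> H B -> P (A `&` B) = (P A * P B)%E.

(* ---------- expectations ---------- *)
Definition Ex (f : T -> R) : R := fine (\int[P]_w (f w)%:E).

(* expectation of a complex-valued random variable *)
Definition CEx (f : T -> R[i]) : R[i] :=
  Complex (Ex (fun w => complex.Re (f w))) (Ex (fun w => complex.Im (f w))).

(* Z is a version of the conditional expectation E[X | G] (coordinatewise) *)
Definition condexp_version {n : nat} (G : set (set T))
    (X Z : T -> 'cV[R]_n) :=
  (forall a, Gmeasurable G (fun w => Z w a 0)) /\
  (forall a, P.-integrable setT (fun w => (Z w a 0)%:E)) /\
  (forall a A, G A ->
     (\int[P]_(w in A) (Z w a 0)%:E = \int[P]_(w in A) (X w a 0)%:E)%E).

(* ---------- norms ---------- *)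
Definition vnorm {n : nat} (v : 'cV[R]_n) : R :=
  Num.sqrt (\sum_(a < n) (v a 0) ^+ 2).

(* Frobenius norm of a complex matrix *)
Definition frob {m n : nat} (A : 'M[R[i]]_(m, n)) : R :=
  Num.sqrt (\sum_(a < m) \sum_(b < n) (complex.Re (A a b) ^+ 2 + complex.Im (A a b) ^+ 2)).

(* ||x||_{L_q} = (E |x|^q)^(1/q), x given through its (nonnegative) norm *)
Definition LqE (q : R) (nx : T -> R) : \bar R :=
  ((\int[P]_w ((nx w) `^ q)%:E) `^ q^-1)%E.

(* ---------- L-mixing ---------- *)
(* M_q(x) = sup_k ||x_k||_{L_q} *)
Definition Mq {n : nat} (q : R) (x : nat -> T -> 'cV[R]_n) : \bar R :=
  ereal_sup (range (fun k => LqE q (fun w => vnorm (x k w)))).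

(* gamma_q(tau, x) = sup_{k >= tau} || x_k - E[x_k | F+_{k-tau}] ||_{L_q},
   where ce k tau is (a version of) E[x_k | F+_{k-tau}] *)
Definition gammaq {n : nat} (q : R) (x : nat -> T -> 'cV[R]_n)
  (ce : nat -> nat -> T -> 'cV[R]_n) (tau : nat) : \bar R :=
  ereal_sup [set LqE q (fun w => vnorm (x k w - ce k tau w)) | k in [set k | (tau <= k)%N]].

(* Gamma_{d,q}(x) = sum_{tau >= 0} gamma_q(tau, x) *)
Definition Gammaq {n : nat} (q : R) (x : nat -> T -> 'cV[R]_n)
  (ce : nat -> nat -> T -> 'cV[R]_n) : \bar R :=
  (\sum_(0 <= tau <oo) gammaq q x ce tau)%E.

(* (x_k) is L-mixing w.r.t. (F, F+); ce k tau is a version of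
   E[x_k | F+_{k-tau}] for tau <= k *)
Definition Lmixing {n : nat} (F : nat -> set (set T))
  (x : nat -> T -> 'cV[R]_n) (ce : nat -> nat -> T -> 'cV[R]_n) :=
  [/\ forall k a, Gmeasurable (F k) (fun w => x k w a 0),
      forall q : R, 1 <= q -> (Mq q x < +oo)%E
    & forall q : R, 1 <= q -> (Gammaq q x ce < +oo)%E].

(* (strict) stationarity: all finite-dimensional distributions are
   shift invariant (checked on measurable rectangles, which generate the
   product sigma-algebra) *)
Definition stationary {n : nat} (x : nat -> T -> 'cV[R]_n) :=
  forall (m : nat) (t : 'I_m -> nat) (B : 'I_m -> 'I_n -> set R) (k : nat),
    (forall j a, measurable (B j a)) ->
    P [set w | forall j a, B j a (x (k + t j)%N w a 0)] =
    P [set w | forall j a, B j a (x (t j) w a 0)].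

(* ---------- the spectral estimator ---------- *)
Section Estimator.
Variables (n M K : nat) (y : nat -> T -> 'cV[R]_n)
          (wt : 'I_M -> R -> R[i]).

Definition toC {p : nat} (v : 'cV[R]_p) : 'cV[R[i]]_p := map_mx (fun r => r%:C)%C v.
Definition ctr {p m : nat} (A : 'M[R[i]]_(p, m)) : 'M[R[i]]_(m, p) :=
  map_mx (fun z => z^*) A^T.

(* mean mu = E[y[k]] (taken at k = 0; independent of k by stationarity) *)
Definition mu : 'cV[R]_n := \col_a Ex (fun w => y 0 w a 0).

Definition ybar (i : nat) (w : T) : 'cV[R]_n :=
  (M%:R)^-1 *: \sum_(k < M) y (i * K + k)%N w.

Definition yhat (i : nat) (s : R) (w : T) : 'cV[R[i]]_n :=
  \sum_(k < M) wt k s *: toC (y (i * K + k)%N w).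

Definition hw (s : R) : R[i] := \sum_(k < M) wt k s.

(* Phibar(s) = E[(yhat_i(s) - h(s) mu)(yhat_i(s) - h(s) mu)^*], taken at i = 0 *)
Definition Phibar (s : R) : 'M[R[i]]_n :=
  \matrix_(a, b) CEx (fun w =>
     let v := yhat 0 s w - hw s *: toC mu in (v *m ctr v) a b).

Definition alpha (j : nat) : R := (j.+1%:R)^-1.

Fixpoint muhat (j : nat) (w : T) : 'cV[R]_n :=
  match j with
  | 0 => 0
  | j'.+1 => muhat j' w + alpha j' *: (ybar j' w - muhat j' w)
  end.

Definition dyhat (j : nat) (s : R) (w : T) : 'cV[R[i]]_n :=
  yhat j s w - hw s *: toC (muhat j w).

Fixpoint Phihat (Phi0 : R -> T -> 'M[R[i]]_n) (j : nat) (s : R) (w : T)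
  : 'M[R[i]]_n :=
  match j with
  | 0 => Phi0 s w
  | j'.+1 => Phihat Phi0 j' s w +
      (alpha j')%:C%C *: (dyhat j' s w *m ctr (dyhat j' s w) - Phihat Phi0 j' s w)
  end.
End Estimator.
(* ---------- the constants of the bound ---------- *)
Section Constants.
Variables (n M K : nat) (y : nat -> T -> 'cV[R]_n)
          (ce : nat -> nat -> T -> 'cV[R]_n).
(* real values of M_q(y), Gamma_{d,q}(y) (finite under L-mixing) *)
Definition Mr (q : R) : R := fine (Mq q y).
Definition Gr (q : R) : R := fine (Gammaq q y ce).
(* floor((M-1)/K) + 1 *)
Definition Lf : R := (((M - 1) %/ K).+1)%:R.
Definition c1 (q : R) : R := 4 * Num.sqrt ((2 * q - 1) * Mr (2 * q) * Gr (2 * q)).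
Definition c2 (q : R) : R := 2 * Lf * c1 q + Lf * Gr (2 * q).
Definition cc (q : R) : R := c1 q * Lf.
Definition bq (q : R) : R :=
  4 * Num.sqrt (6 * (2 * q - 1) * c1 (2 * q) ^+ 3 * c2 (2 * q))
  + 6 * c1 (2 * q) * cc (2 * q) + 2 * cc (2 * q) ^+ 2.
End Constants.
End Defs.

(* Main.v *)
Require Import Defs.
From HB Require Import structures.
From mathcomp Require Import all_boot all_order all_algebra.
From mathcomp Require Import all_classical all_reals all_analysis.
From mathcomp Require Import measurable_realfun.
From mathcomp Require Import complex.
From mathcomp Require Import ring lra zify.
Import Order.TTheory GRing.Theory Num.Theory.
Local Open Scope classical_set_scope.
Local Open Scope ring_scope.

(* Write z_i for the centred window transform, e_j for the error of the running
   mean and h for the sum of the weights.  Since alpha_j = 1/(j+1), the estimator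
   at time k is the average over j < k of (z_j - h e_j)(z_j - h e_j)^*, so its
   error splits into the average of z_j z_j^* - Phibar and plug-in terms of size
   |h e_j| (2 |z_j| + |h e_j|).

   Everything rests on one moment inequality for sums S_n of centred vectors
   X_k, X_k being F_k-measurable and approximated by centred Z_(k,j) that are
   measurable for F^+_j:
     |S_n|_p^2 <= 8 (p - 1) sum_(j <= k < n) |X_j|_p |X_k - Z_(k,j)|_p,   p >= 2.
   It is proved by expanding E |S_(k+1)|^p - E |S_k|^p through the gradient of
   |.|^p, telescoping this gradient along S_0, ..., S_(k+1), and using that an
   F_j-measurable vector is orthogonal to Z_(k,j), so that X_k may be replaced by
   X_k - Z_(k,j).  Applied to weighted sums of y - mu it bounds z_j and e_j in
   L_(4q) through the constant c_1; applied to z_j z_j^*, with approximants built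
   from conditional expectations, it bounds the main term in L_(2q). *)

Set Implicit Arguments.
Unset Strict Implicit.

(** The gradient argument needs an exponent at least 2, while [q] may be as small as 1. The estimate
    is therefore made at [p = 2 * q] and brought down to [q] by monotonicity of the L-norms; as the
    outer product is quadratic, the transforms themselves are needed in L_(2p) = L_(4q). Hence the
    constants are taken at [2 * q].

    Overlapping windows are the main obstacle: the end of window i may lie inside window j, and
    samples before it cannot be approximated from the future of that time. They are replaced by
    their mean, at a cost bounded by [c1]; this happens for boundedly many lags j - i, whence the
    [c1] term of [c2].

    Origin of the constants: centring doubles a norm. For y - mu only the size is doubled, and 8 (p
    - 1) 2 M Gamma = 4^2 (p - 1) M Gamma gives [c1]. For outer products both the size C^2 and the
    approximation error 3 C zerr are doubled, and 8 * 2 * 6 = 4^2 * 6 gives the first term of [bq].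
    The term of order 1/k comes from j = 0 alone, where the running mean is still 0 and its error is
    -mu. *)

Section EuclideanNorm.
Context {R : realType} {I : finType}.
Implicit Types (u v : I -> R) (p : R).

(** Vectors are functions on an arbitrary finite index type, so that real vectors, complex vectors
    and complex matrices in real coordinates share one theory. *)
Definition dot u v : R := \sum_i u i * v i.
Definition nrm u : R := Num.sqrt (\sum_i u i ^+ 2).

Lemma nrm_ge0 u : 0 <= nrm u. Proof. exact: sqrtr_ge0. Qed.

Lemma nrm_sqr u : nrm u ^+ 2 = \sum_i u i ^+ 2.
Proof. by rewrite sqr_sqrtr// sumr_ge0// => i _; exact: sqr_ge0. Qed.

Lemma dotuu u : dot u u = nrm u ^+ 2.
Proof. by rewrite nrm_sqr; apply: eq_bigr => i _; rewrite expr2. Qed.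

Lemma nrm_coord u i : `|u i| <= nrm u.
Proof.
rewrite -sqrtr_sqr ler_wsqrtr// (bigD1 i)//= lerDl sumr_ge0// => j _.
exact: sqr_ge0.
Qed.

Lemma nrm0_eq0 u : nrm u = 0 -> forall i, u i = 0.
Proof.
by move=> u0 i; apply/normr0_eq0/le_anti; rewrite normr_ge0 -u0 nrm_coord.
Qed.

Lemma dot_le u v : dot u v <= nrm u * nrm v.
Proof.
have [u0|u0] := eqVneq (nrm u) 0.
  by rewrite u0 mul0r /dot big1// => i _; rewrite nrm0_eq0// mul0r.
have [v0|v0] := eqVneq (nrm v) 0.
  by rewrite v0 mulr0 /dot big1// => i _; rewrite (nrm0_eq0 v0) mulr0.
have up : 0 < nrm u by rewrite lt_def u0 nrm_ge0.
have vp : 0 < nrm v by rewrite lt_def v0 nrm_ge0.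
have : 0 <= \sum_i (nrm v * u i - nrm u * v i) ^+ 2.
  by apply: sumr_ge0 => i _; exact: sqr_ge0.
have -> : \sum_i (nrm v * u i - nrm u * v i) ^+ 2 =
    nrm v ^+ 2 * \sum_i u i ^+ 2 - 2 * (nrm u * nrm v) * dot u v
    + nrm u ^+ 2 * \sum_i v i ^+ 2.
  rewrite /dot !mulr_sumr -sumrB -big_split/=.
  by apply: eq_bigr => i _; ring.
rewrite -!nrm_sqr => h.
rewrite -(ler_pM2l (mulr_gt0 up vp)); nra.
Qed.

Lemma nrmD u v : nrm (fun i => u i + v i) <= nrm u + nrm v.
Proof.
rewrite -(@ler_pXn2r _ 2)// ?nnegrE ?addr_ge0 ?nrm_ge0//.
rewrite sqrrD !nrm_sqr.
have -> : \sum_i (u i + v i) ^+ 2 =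
    \sum_i u i ^+ 2 + dot u v *+ 2 + \sum_i v i ^+ 2.
  rewrite /dot -sumrMnl -!big_split/=.
  by apply: eq_bigr => i _; rewrite sqrrD.
by rewrite lerD2r lerD2l lerMn2r dot_le.
Qed.

Lemma nrmZ (a : R) u : nrm (fun i => a * u i) = `|a| * nrm u.
Proof.
rewrite -sqrtr_sqr -sqrtrM ?sqr_ge0//; congr Num.sqrt.
by rewrite mulr_sumr; apply: eq_bigr => i _; rewrite exprMn.
Qed.

Lemma nrmN u : nrm (fun i => - u i) = nrm u.
Proof. by congr Num.sqrt; apply: eq_bigr => i _; rewrite sqrrN. Qed.

Lemma nrmB u v : nrm (fun i => u i - v i) <= nrm u + nrm v.
Proof. by rewrite -(nrmN v); exact: nrmD. Qed.

Lemma nrmBC u v : nrm (fun i => u i - v i) = nrm (fun i => v i - u i).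
Proof. by congr Num.sqrt; apply: eq_bigr => i _; rewrite -sqrrN opprB. Qed.

Lemma eq_nrm u v : u =1 v -> nrm u = nrm v.
Proof. by move=> uv; congr Num.sqrt; apply: eq_bigr => i _; rewrite uv. Qed.

Lemma nrm0 : nrm (fun=> 0) = 0.
Proof. by rewrite /nrm big1 ?sqrtr0// => i _; rewrite expr0n. Qed.

Lemma nrm_sum (J : Type) (r : seq J) (P : pred J) (F : J -> I -> R) :
  nrm (fun i => \sum_(j <- r | P j) F j i) <= \sum_(j <- r | P j) nrm (F j).
Proof.
elim: r => [|j r IH].
  by rewrite big_nil (@eq_nrm _ (fun=> 0)) ?nrm0// => i; rewrite big_nil.
under eq_nrm => i do rewrite big_cons.
rewrite big_cons; case: ifP => // _.
by rewrite (le_trans (nrmD _ _))// lerD2l.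
Qed.

(* [powgrad p] is the gradient of [nrm ^ p / p]. *)
Definition powgrad p u : I -> R := fun i => nrm u `^ (p - 2) * u i.

Lemma nrm_powgrad p u : 2 <= p -> nrm (powgrad p u) = nrm u `^ (p - 1).
Proof.
move=> p2; rewrite nrmZ ger0_norm ?powR_ge0// mulrC.
rewrite (_ : p - 2 = p - 1 - 1); last by ring.
by rewrite mulr_powRB1 ?nrm_ge0//; lra.
Qed.

Lemma dot_powgrad p u : 2 <= p -> dot (powgrad p u) u = nrm u `^ p.
Proof.
move=> p2.
have -> : dot (powgrad p u) u = nrm u `^ (p - 2) * nrm u ^+ 2.
  by rewrite nrm_sqr mulr_sumr; apply: eq_bigr => i _; rewrite /powgrad; ring.
rewrite expr2 mulrA -[X in X * _]mulrC (_ : p - 2 = p - 1 - 1); last by ring.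
by rewrite mulr_powRB1 ?nrm_ge0 1?mulrC ?mulr_powRB1 ?nrm_ge0//; lra.
Qed.

End EuclideanNorm.

(** * Elementary inequalities for real powers *)

Section RealPowers.
Context {R : realType}.
Implicit Types a b c p x y s : R.

(** Young's inequality for the exponents p/(p-1) and p, multiplied by p; in this form it includes p
    = 1, where the conjugate exponent is infinite. *)
Lemma young_powR p a b : 1 <= p -> 0 <= a -> 0 <= b ->
  p * (a `^ (p - 1) * b) <= (p - 1) * a `^ p + b `^ p.
Proof.
move=> p1 a0 b0.
have [->|pn1] := eqVneq p 1.
  by rewrite subrr powRr0 !mul1r mul0r add0r powRr1.
have pp : 0 < p - 1 by rewrite subr_gt0 lt_def pn1 p1.
have p0 : 0 < p by lra.
have := @conjugate_powR R (a `^ (p - 1)) b (p / (p - 1)) p (powR_ge0 _ _) b0.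
rewrite -powRrM [_ * (p / _)]mulrC divfK ?gt_eqF// => h.
have /h{}h : 0 < p / (p - 1) by rewrite divr_gt0.
have /(h p0){}h : (p / (p - 1))^-1 + p^-1 = 1 by field; rewrite !gt_eqF//.
have -> : (p - 1) * a `^ p + b `^ p = p * (a `^ p / (p / (p - 1)) + b `^ p / p).
  by field; rewrite !gt_eqF.
by rewrite ler_pM2l.
Qed.

(** Young's inequality at [a = 1] and [b = 1 + x]. *)
Lemma bernoulli_powR p x : 1 <= p -> 0 <= x -> 1 + p * x <= (1 + x) `^ p.
Proof.
move=> p1 x0.
have := @young_powR p 1 (1 + x) p1 ler01.
by rewrite !powR1 mul1r mulr1 => /(_ (ltac:(lra))); lra.
Qed.

(* Going through [ln t <= t - 1] covers the exponents [s < 1] as well, for which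
   [t `^ s] is not convex. *)
Lemma powR_diff_bound s a b : 0 <= s -> 0 <= b -> b <= a ->
  (a `^ s - b `^ s) * b <= s * a `^ s * (a - b).
Proof.
move=> s0; rewrite le_eqVlt => /predU1P[<- a0|b0 ba].
  by rewrite mulr0 subr0 mulr_ge0// mulr_ge0 ?powR_ge0.
have a0 : 0 < a by rewrite (lt_le_trans b0).
have r0 : 0 < b / a by rewrite divr_gt0.
have -> : b `^ s = a `^ s * (b / a) `^ s.
  by rewrite -powRM ?ltW// mulrCA divff ?gt_eqF// mulr1.
have -> : (a `^ s - a `^ s * (b / a) `^ s) * b = a `^ s * ((1 - (b / a) `^ s) * b) by ring.
rewrite -mulrA [s * _]mulrCA ler_wpM2l ?powR_ge0//.
have h1 : 1 + s * ln (b / a) <= (b / a) `^ s.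
  by rewrite /powR gt_eqF// expR_ge1Dx.
have h2 : ln (a / b) <= a / b - 1.
  have := @le_ln1Dx R (a / b - 1).
  by rewrite (addrC 1) subrK; apply; rewrite -subr_gt0 opprK subrK divr_gt0.
have h3 : ln (b / a) = - ln (a / b).
  by rewrite -lnV ?posrE ?divr_gt0// invf_div.
rewrite h3 in h1.
have h4 : (1 - (b / a) `^ s) <= s * (a / b - 1).
  apply: (@le_trans _ _ (s * ln (a / b))); first lra.
  by rewrite ler_wpM2l.
apply: (@le_trans _ _ (s * (a / b - 1) * b)); first by rewrite ler_wpM2r// ltW.
by rewrite -mulrA mulrBl mul1r divfK// gt_eqF.
Qed.

(** Young's inequality for the exponents p, p/(p-2), p, including p = 2. The two-factor form with
    exponent p/2 is applied to s^2 and xy, then (xy)^(p/2) is split by the arithmetic-geometric mean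
    inequality. *)
Lemma young3_powR p x s y : 2 <= p -> 0 <= x -> 0 <= s -> 0 <= y ->
  p * (x * s `^ (p - 2) * y) <= x `^ p + (p - 2) * s `^ p + y `^ p.
Proof.
move=> p2 x0 s0 y0.
have xy : (x * y) `^ (p / 2) <= (x `^ p + y `^ p) / 2.
  rewrite powRM//.
  have sq z : 0 <= z -> z `^ p = (z `^ (p / 2)) ^+ 2.
    by move=> z0; rewrite -powR_mulrn ?powR_ge0// -powRrM divfK.
  rewrite (sq x)// (sq y)//.
  by have := sqr_ge0 (x `^ (p / 2) - y `^ (p / 2)); nra.
have := @young_powR (p / 2) (s ^+ 2) (x * y).
rewrite -!powR_mulrn// -!powRrM.
have -> : 2 * (p / 2 - 1) = p - 2 by field.
have -> : 2 * (p / 2) = p by field.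
move=> /(_ (ltac:(lra)) (powR_ge0 _ _) (mulr_ge0 x0 y0)).
move: (s `^ (p - 2)) (s `^ p) xy => A B.
by move: ((x * y) `^ (p / 2)) (x `^ p) (y `^ p) => U V W; nra.
Qed.

Lemma expR1_le3 : expR 1 <= 3 :> R.
Proof.
(* exp (-1/6) >= 5/6 gives e <= (6/5)^6 < 3. *)
have h : 1 + - (6^-1) <= expR (- 6^-1) :> R by exact: expR_ge1Dx.
have e6 : expR (1 : R) = (expR (- 6^-1))^-1 ^+ 6.
  by rewrite -expRN opprK -expRM_natl divff.
rewrite e6.
have h5 : (expR (- 6^-1))^-1 <= 6 / 5 :> R.
  rewrite invf_ple ?posrE ?expR_gt0 ?divr_gt0//; apply: le_trans h; lra.
apply: (@le_trans _ _ ((6 / 5) ^+ 6)); last lra.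
by rewrite lerXn2r ?nnegrE ?invr_ge0 ?expR_ge0// divr_ge0.
Qed.

(** The left side is at most e^((p-2)/p) <= e. This controls the growth of |S|^(p-2) when |S| grows
    by a factor of at most 1 + 1/p. *)
Lemma powR_1Dinv_le3 p : 2 <= p -> (1 + p^-1) `^ (p - 2) <= 3.
Proof.
move=> p2; have p0 : 0 < p by lra.
apply: le_trans expR1_le3.
apply: (@le_trans _ _ (expR (p^-1) `^ (p - 2))).
  by rewrite ge0_ler_powR ?nnegrE ?expR_ge0 ?expR_ge1Dx ?subr_ge0// addr_ge0// invr_ge0 ltW.
rewrite -expRM ler_expR mulrBr mulVf ?gt_eqF// gerBl.
by rewrite mulr_ge0// invr_ge0 ltW.
Qed.

End RealPowers.

(** * Convexity and Lipschitz estimates for the gradient of a power of the norm *)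

Section PowerGradient.
Context {R : realType} {I : finType}.
Implicit Types (u v y : I -> R) (p : R).

(** The tangent at [u] lies below the convex function |.|^p. With [u] the new partial sum and [v]
    the old one, no second-order remainder is left, at the price of a gradient at a point that
    contains the new increment. *)
Lemma nrm_pow_convex p u v : 2 <= p ->
  nrm u `^ p <= nrm v `^ p + p * dot (powgrad p u) (fun i => u i - v i).
Proof.
move=> p2.
have -> : dot (powgrad p u) (fun i => u i - v i) = nrm u `^ p - dot (powgrad p u) v.
  by rewrite -dot_powgrad// /dot -sumrB; apply: eq_bigr => i _; ring.
have h1 : dot (powgrad p u) v <= nrm u `^ (p - 1) * nrm v.
  by rewrite -nrm_powgrad//; exact: dot_le.
have := @young_powR R p (nrm u) (nrm v) (ltac:(lra)) (nrm_ge0 _) (nrm_ge0 _).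
move: h1; move: (dot _ v) (nrm u `^ (p - 1) * nrm v) => A B AB.
have : p * A <= p * B by rewrite ler_pM2l//; lra.
lra.
Qed.

(** The sum of both powers, rather than the larger one, lets Hoelder's inequality act on each
    summand separately. *)
Lemma powgrad_diff_le p u v : 2 <= p ->
  nrm (fun i => powgrad p u i - powgrad p v i) <=
  (p - 1) * nrm (fun i => u i - v i) * (nrm u `^ (p - 2) + nrm v `^ (p - 2)).
Proof.
move=> p2.
wlog uv : u v / nrm v <= nrm u.
  move=> H; have [|] := leP (nrm v) (nrm u); first exact: H.
  by move=> /ltW/H; rewrite nrmBC (nrmBC v) (addrC (nrm v `^ _)).
(* The larger norm multiplies [u - v]; the change of the scalar factor multiplies the shorter vector
   [v], as [powR_diff_bound] requires. *)
have -> : nrm (fun i => powgrad p u i - powgrad p v i) =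
    nrm (fun i => nrm u `^ (p - 2) * (u i - v i)
                + (nrm u `^ (p - 2) - nrm v `^ (p - 2)) * v i).
  by apply: eq_nrm => i; rewrite /powgrad; ring.
apply: (le_trans (nrmD _ _)); rewrite !nrmZ ger0_norm ?powR_ge0//.
rewrite ger0_norm ?subr_ge0; last first.
  by rewrite ge0_ler_powR ?nnegrE ?nrm_ge0// subr_ge0.
have h1 := @powR_diff_bound R (p - 2) (nrm u) (nrm v) (ltac:(lra)) (nrm_ge0 _) uv.
have h2 : nrm u - nrm v <= nrm (fun i => u i - v i).
  rewrite lerBlDr; apply: le_trans (nrmD _ _).
  by rewrite (@eq_nrm _ _ u (fun i => u i - v i + v i))// => i; rewrite subrK.
have c0 : 0 <= (p - 2) * nrm u `^ (p - 2) by rewrite mulr_ge0 ?powR_ge0 ?subr_ge0.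
have h3 := ler_wpM2l c0 h2.
have h4 : 0 <= (p - 1) * nrm (fun i => u i - v i) * nrm v `^ (p - 2).
  by rewrite !mulr_ge0 ?powR_ge0 ?nrm_ge0//; lra.
move: h1 h3 h4; lra.
Qed.

End PowerGradient.

(** * Expectations and L_p bounds of real random variables *)

Section RealExpectation.
Context {R : realType} {d : measure_display} {T : measurableType d}.
Variable P : probability T R.
Implicit Types (f g : T -> R) (p c : R).

Definition rintegrable f := P.-integrable setT (fun w => (f w)%:E).

Lemma rintegrable_meas f : rintegrable f -> measurable_fun setT f.
Proof. by move=> /measurable_int/measurable_EFinP. Qed.

Lemma rintegrableD f g : rintegrable f -> rintegrable g ->
  rintegrable (fun w => f w + g w).
Proof.
move=> fi gi; have := integrableD measurableT fi gi.
by apply: eq_integrable => // w _.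
Qed.

Lemma rintegrableZ (a : R) f : rintegrable f -> rintegrable (fun w => a * f w).
Proof.
move=> fi; have := integrableZl measurableT a fi.
by apply: eq_integrable => // w _.
Qed.

Lemma rintegrableN f : rintegrable f -> rintegrable (fun w => - f w).
Proof.
move=> /(rintegrableZ (-1)); apply: eq_integrable => // w _.
by rewrite mulN1r.
Qed.

Lemma rintegrableB f g : rintegrable f -> rintegrable g ->
  rintegrable (fun w => f w - g w).
Proof. by move=> fi gi; exact: (rintegrableD fi (rintegrableN gi)). Qed.

Lemma rintegrable_cst c : rintegrable (fun=> c).
Proof. exact: finite_measure_integrable_cst. Qed.

Lemma rintegrable_sum (J : Type) (r : seq J) (Q : pred J) (F : J -> T -> R) :
  (forall j, Q j -> rintegrable (F j)) ->
  rintegrable (fun w => \sum_(j <- r | Q j) F j w).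
Proof.
move=> iF; elim: r => [|j r IH].
  have := rintegrable_cst 0; apply: eq_integrable => // w _.
  by rewrite big_nil.
have [Qj|Qj] := boolP (Q j).
  have := rintegrableD (iF _ Qj) IH; apply: eq_integrable => // w _.
  by rewrite big_cons Qj.
by move: IH; apply: eq_integrable => // w _; rewrite big_cons (negPf Qj).
Qed.

Lemma rintegrable_le f g : measurable_fun setT f -> rintegrable g ->
  (forall w, `|f w| <= g w) -> rintegrable f.
Proof.
move=> mf ig fg; apply: (le_integrable _ _ _ ig) => //.
  exact/measurable_EFinP.
by move=> w _; rewrite /= lee_fin (le_trans (fg w))// ler_norm.
Qed.

Lemma rintegrable_eq f g : f =1 g -> rintegrable f -> rintegrable g.
Proof. by move=> fg; apply: eq_integrable => // w _; rewrite fg. Qed.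

Lemma eq_Ex f g : f =1 g -> Ex P f = Ex P g.
Proof. by move=> fg; congr Ex; apply/funext. Qed.

Lemma ExD f g : rintegrable f -> rintegrable g ->
  Ex P (fun w => f w + g w) = Ex P f + Ex P g.
Proof. exact: RintegralD. Qed.

Lemma ExB f g : rintegrable f -> rintegrable g ->
  Ex P (fun w => f w - g w) = Ex P f - Ex P g.
Proof. exact: RintegralB. Qed.

Lemma ExZ (a : R) f : rintegrable f -> Ex P (fun w => a * f w) = a * Ex P f.
Proof. by move=> fi; exact: RintegralZl. Qed.

Lemma Ex_cst c : Ex P (fun=> c) = c.
Proof.
rewrite -[LHS]/(Rintegral P setT (fun=> c)) Rintegral_cst//.
rewrite [X in fine X](_ : _ = 1%E) ?mulr1//.
exact: (probability_setT P).
Qed.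

Lemma Ex_sum (J : Type) (r : seq J) (Q : pred J) (F : J -> T -> R) :
  (forall j, Q j -> rintegrable (F j)) ->
  Ex P (fun w => \sum_(j <- r | Q j) F j w) = \sum_(j <- r | Q j) Ex P (F j).
Proof.
move=> iF; elim: r => [|j r IH].
  by rewrite big_nil -[RHS](Ex_cst 0); apply: eq_Ex => w; rewrite big_nil.
rewrite big_cons; case: ifP => Qj.
  rewrite -IH -ExD//; [|exact: iF|exact: rintegrable_sum].
  by apply: eq_Ex => w; rewrite big_cons Qj.
by rewrite -IH; apply: eq_Ex => w; rewrite big_cons Qj.
Qed.

Lemma Ex_le f g : rintegrable f -> rintegrable g ->
  (forall w, f w <= g w) -> Ex P f <= Ex P g.
Proof. by move=> fi gi fg; apply: le_Rintegral => // w _. Qed.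

Lemma EFin_Ex f : rintegrable f -> (Ex P f)%:E = (\int[P]_w (f w)%:E)%E.
Proof. by move=> fi; rewrite fineK//; exact: integrable_fin_num. Qed.

Lemma measurable_powRn p f : measurable_fun setT f ->
  measurable_fun setT (fun w => f w `^ p).
Proof. by move=> mf; exact: (@measurableT_comp _ _ _ _ _ _ (@powR R ^~ p)). Qed.

(** A bound by a real number, bundled with the measurability and sign conditions that the next
    estimate needs; for p > 0 it also yields integrability of f^p. *)
Definition Lbound p f c :=
  [/\ measurable_fun setT f, (forall w, 0 <= f w), 0 <= c & (LqE P p f <= c%:E)%E].

Lemma LboundP p f c : 0 < p -> Lbound p f c <->
  [/\ measurable_fun setT f, (forall w, 0 <= f w), 0 <= c,
      rintegrable (fun w => f w `^ p) & Ex P (fun w => f w `^ p) <= c `^ p].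
Proof.
move=> p0.
have i0 : (0 <= \int[P]_w (f w `^ p)%:E)%E.
  by apply: integral_ge0 => w _; rewrite lee_fin powR_ge0.
split=> [[mf f0 c0 fc]|[mf f0 c0 fi fc]].
- have ip : (\int[P]_w (f w `^ p)%:E <= (c `^ p)%:E)%E.
    have := @gt0_ler_poweR R p (ltW p0) _ _ _ _ fc.
    rewrite -poweRrM mulVf ?gt_eqF// poweRe1// poweR_EFin; apply.
      by rewrite in_itv/= poweR_ge0 leey.
    by rewrite in_itv/= lee_fin c0 leey.
  have fi : rintegrable (fun w => f w `^ p).
    apply/integrableP; split; first exact/measurable_EFinP/measurable_powRn.
    apply: le_lt_trans (ltry (c `^ p)).
    by under eq_integral => w _ do rewrite gee0_abs ?lee_fin ?powR_ge0//.
  by split => //; rewrite -lee_fin EFin_Ex.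
- split=> //; move: fc; rewrite -lee_fin EFin_Ex// => fc.
  have := @gt0_ler_poweR R (p^-1) _ _ _ _ _ fc.
  rewrite poweR_EFin -powRrM divff ?gt_eqF// powRr1//; apply.
  + by rewrite invr_ge0 ltW.
  + by rewrite in_itv/= i0 leey.
  + by rewrite in_itv/= lee_fin powR_ge0 leey.
Qed.

Lemma Lbound_widen p f c c' : c <= c' -> Lbound p f c -> Lbound p f c'.
Proof.
move=> cc' [mf f0 c0 fc]; split => //; first exact: le_trans cc'.
by rewrite (le_trans fc)// lee_fin.
Qed.

Lemma Lbound_le p f g c : 0 < p -> measurable_fun setT g ->
  (forall w, 0 <= g w) -> (forall w, g w <= f w) -> Lbound p f c -> Lbound p g c.
Proof.
move=> p0 mg g0 gf /(LboundP _ _ p0)[mf f0 c0 fi fc]; apply/LboundP => //.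
have gfp w : g w `^ p <= f w `^ p.
  by rewrite ge0_ler_powR ?nnegrE//; exact: ltW.
have gi : rintegrable (fun w => g w `^ p).
  apply: (rintegrable_le _ fi); first exact: measurable_powRn.
  by move=> w; rewrite ger0_norm ?powR_ge0.
by split=> //; apply: le_trans fc; exact: Ex_le.
Qed.

Lemma Lbound_eq p f g c : f =1 g -> Lbound p f c -> Lbound p g c.
Proof. by move=> /funext ->. Qed.

Lemma Lbound_cst p c : 0 < p -> 0 <= c -> Lbound p (fun=> c) c.
Proof.
move=> p0 c0; apply/LboundP => //; split=> //; first exact: rintegrable_cst.
by rewrite Ex_cst.
Qed.

Lemma Lbound_Z p f c (a : R) : 0 < p -> 0 <= a -> Lbound p f c ->
  Lbound p (fun w => a * f w) (a * c).
Proof.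
move=> p0 a0 /(LboundP _ _ p0)[mf f0 c0 fi fc]; apply/LboundP => //.
have e w : a `^ p * f w `^ p = (a * f w) `^ p by rewrite powRM.
split=> //.
- exact: measurable_funM.
- by move=> w; rewrite mulr_ge0.
- by rewrite mulr_ge0.
- exact: rintegrable_eq e (rintegrableZ _ fi).
- by rewrite -(eq_Ex e) ExZ// powRM// ler_wpM2l// powR_ge0.
Qed.

Lemma LqE_Lnorm p f : (forall w, 0 <= f w) ->
  LqE P p f = Lnorm P p%:E (EFin \o f).
Proof.
move=> f0; rewrite /LqE unlock; congr (_ `^ _)%E; apply: eq_integral => w _.
by rewrite gee0_abs ?lee_fin// poweR_EFin.
Qed.

Lemma LboundD p f g a b : 1 <= p -> Lbound p f a -> Lbound p g b ->
  Lbound p (fun w => f w + g w) (a + b).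
Proof.
move=> p1 [mf f0 a0 fa] [mg g0 b0 gb]; split.
- exact: measurable_funD.
- by move=> w; rewrite addr_ge0.
- by rewrite addr_ge0.
rewrite LqE_Lnorm; last by move=> w; rewrite addr_ge0.
apply: (le_trans (@minkowski_EFin _ _ _ P f g p mf mg p1)).
by rewrite EFinD leeD// -LqE_Lnorm.
Qed.

Lemma Lbound_sum p (J : Type) (r : seq J) (Q : pred J) (F : J -> T -> R) (a : J -> R) :
  1 <= p -> (forall j, Q j -> Lbound p (F j) (a j)) ->
  Lbound p (fun w => \sum_(j <- r | Q j) F j w) (\sum_(j <- r | Q j) a j).
Proof.
move=> p1 Fa; elim: r => [|j r IH].
  rewrite big_nil (_ : (fun w => _) = (fun=> 0)); last first.
    by apply/funext => w; rewrite big_nil.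
  by apply: Lbound_cst => //; exact: lt_le_trans p1.
rewrite big_cons (_ : (fun w => _) =
  fun w => (if Q j then F j w + \sum_(j <- r | Q j) F j w
            else \sum_(j <- r | Q j) F j w)); last first.
  by apply/funext => w; rewrite big_cons.
by case: ifPn => // /Fa Fj; exact: LboundD.
Qed.

(** Later proofs divide by their bounds. Proving the claim for enlarged, hence positive, bounds and
    letting [e] tend to 0 covers the degenerate case. *)
Lemma Lbound_closed p f c k : 0 <= c -> 0 <= k ->
  (forall e, 0 < e -> e <= 1 -> Lbound p f (c + e * k)) -> Lbound p f c.
Proof.
move=> c0 k0 H; have [mf f0 _ _] := H 1 ltr01 (lexx _).
split => //; apply/lee_addgt0Pr => e e0.
pose e' := Num.min 1 (e / (k + 1)).
have k1 : 0 < k + 1 by rewrite ltr_wpDl.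
have e'0 : 0 < e' by rewrite lt_min ltr01 divr_gt0.
have [|_ _ _ /le_trans] := H e' e'0; first by rewrite ge_min lexx.
apply; rewrite -EFinD lee_fin lerD2l.
have : e' <= e / (k + 1) by rewrite ge_min lexx orbT.
by rewrite ler_pdivlMr// => h; nra.
Qed.

Lemma Lbound_rintegrable p f c : 0 < p -> Lbound p f c ->
  rintegrable (fun w => f w `^ p).
Proof. by move=> p0 /(LboundP _ _ p0)[]. Qed.

Lemma Lbound_mean p f c : 0 < p -> Lbound p f c -> Ex P (fun w => f w `^ p) <= c `^ p.
Proof. by move=> p0 /(LboundP _ _ p0)[]. Qed.

Lemma Lbound_mono p p' f c : 0 < p -> p <= p' -> Lbound p' f c -> Lbound p f c.
Proof.
move=> p0 pp' fc; have p'0 : 0 < p' by exact: lt_le_trans pp'.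
have c0 : 0 <= c by case: fc.
apply: (@Lbound_closed _ _ _ 1) => // e e0 _; rewrite mulr1.
have {}fc : Lbound p' f (c + e) by apply: Lbound_widen fc; rewrite lerDl ltW.
move: (c + e) (ltr_wpDl c0 e0) fc => {e e0 c0}c c0 /(LboundP _ _ p'0)[mf f0 _ fi fc].
(* With t = (f/c)^p this is the tangent bound t <= (p/p') t^(p'/p) + 1 - p/p', multiplied by c^p
   c^p'. *)
have key w : c `^ p' * f w `^ p <= c `^ p * ((p / p') * f w `^ p' + (1 - p / p') * c `^ p').
  have := @young_powR R (p' / p) 1 ((f w / c) `^ p) _ ler01 (powR_ge0 _ _).
  rewrite ler_pdivlMr// mul1r => /(_ pp').
  rewrite !powR1 mul1r mulr1 -powRrM [p * _]mulrCA mulfV ?gt_eqF// mulr1.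
  have fw x : f w `^ x = (f w / c) `^ x * c `^ x.
    by rewrite -powRM ?divr_ge0 ?(ltW c0)// divfK// gt_eqF.
  rewrite (fw p) (fw p') => h.
  have -> : c `^ p' * ((f w / c) `^ p * c `^ p) =
    (c `^ p * c `^ p' * (p / p')) * (p' / p * (f w / c) `^ p) by field; rewrite !gt_eqF.
  have -> : c `^ p * (p / p' * ((f w / c) `^ p' * c `^ p') + (1 - p / p') * c `^ p') =
    (c `^ p * c `^ p' * (p / p')) * (p' / p - 1 + (f w / c) `^ p').
    by field; rewrite !gt_eqF.
  by rewrite ler_wpM2l// !mulr_ge0 ?powR_ge0 ?invr_ge0 ?ltW.
have cp : 0 < c `^ p' by rewrite powR_gt0.
have gi : rintegrable (fun w => c `^ p * ((p / p') * f w `^ p' + (1 - p / p') * c `^ p')).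
  by apply/rintegrableZ/rintegrableD; [exact: rintegrableZ|exact: rintegrable_cst].
have fpi : rintegrable (fun w => c `^ p' * f w `^ p).
  apply: (rintegrable_le _ gi); first by apply: measurable_funM => //; exact: measurable_powRn.
  by move=> w; rewrite ger0_norm// mulr_ge0 ?powR_ge0.
have fpi' : rintegrable (fun w => f w `^ p).
  have := rintegrableZ ((c `^ p')^-1) fpi; apply: rintegrable_eq => w.
  by rewrite mulKf// gt_eqF.
apply/LboundP => //; split => //; first exact: ltW.
rewrite -(ler_pM2l cp) -ExZ//; apply: le_trans (Ex_le fpi gi key) _.
rewrite ExZ; last by apply/rintegrableD; [exact: rintegrableZ|exact: rintegrable_cst].
rewrite ExD ?Ex_cst; [|exact: rintegrableZ|exact: rintegrable_cst].
rewrite ExZ// mulrC ler_wpM2r ?powR_ge0//.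
have r0 : 0 <= p / p' by rewrite divr_ge0 ?ltW.
have := ler_wpM2l r0 fc; lra.
Qed.

Lemma Lbound_Ex p f c : 1 <= p -> Lbound p f c -> rintegrable f /\ Ex P f <= c.
Proof.
move=> p1 /(Lbound_mono ltr01 p1)/(LboundP _ _ ltr01)[mf f0 c0 fi].
have e w : f w `^ 1 = f w by rewrite powRr1.
by rewrite powRr1// (eq_Ex e); split => //; exact: rintegrable_eq e fi.
Qed.

Lemma LboundM p f g a b : 0 < p -> Lbound (2 * p) f a -> Lbound (2 * p) g b ->
  Lbound p (fun w => f w * g w) (a * b).
Proof.
move=> p0 fa gb; have p20 : 0 < 2 * p by rewrite mulr_gt0.
have a0 : 0 <= a by case: fa.
have b0 : 0 <= b by case: gb.
apply: (@Lbound_closed _ _ _ (a + b + 1)); rewrite ?addr_ge0 ?mulr_ge0// => e e0 e1.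
apply: (@Lbound_widen _ _ ((a + e) * (b + e))); first nra.
have {}fa : Lbound (2 * p) f (a + e) by apply: Lbound_widen fa; rewrite lerDl ltW.
have {}gb : Lbound (2 * p) g (b + e) by apply: Lbound_widen gb; rewrite lerDl ltW.
move: (a + e) (b + e) (ltr_wpDl a0 e0) (ltr_wpDl b0 e0) fa gb
  => {e e0 e1 a0 b0}a {}b a0 b0 /(LboundP _ _ p20)[mf f0 _ fi fa] /(LboundP _ _ p20)[mg g0 _ gi gb].
have sq (z : R) : 0 <= z -> z `^ (2 * p) = (z `^ p) ^+ 2.
  by move=> z0; rewrite -powR_mulrn ?powR_ge0// -powRrM mulrC.
pose A := a `^ p; pose B := b `^ p.
have A0 : 0 < A by rewrite powR_gt0.
have B0 : 0 < B by rewrite powR_gt0.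
(* A weighted arithmetic-geometric mean inequality; the weights B/A and A/B make both means at most
   A B / 2. *)
have key w : (f w * g w) `^ p <= (B / A / 2) * f w `^ (2 * p) + (A / B / 2) * g w `^ (2 * p).
  rewrite powRM// !sq//; move: (f w `^ p) (g w `^ p) (powR_ge0 (f w) p) (powR_ge0 (g w) p) => x y x0 y0.
  have -> : B / A / 2 * x ^+ 2 + A / B / 2 * y ^+ 2 = x * y + (B * x - A * y) ^+ 2 / (2 * (A * B)).
    by field; rewrite !gt_eqF.
  by rewrite lerDl divr_ge0 ?sqr_ge0// !mulr_ge0// ltW.
have hi : rintegrable (fun w => (B / A / 2) * f w `^ (2 * p) + (A / B / 2) * g w `^ (2 * p)).
  by apply/rintegrableD; exact: rintegrableZ.
have mfg : measurable_fun setT (fun w => f w * g w) by exact: measurable_funM.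
have fgi : rintegrable (fun w => (f w * g w) `^ p).
  apply: (rintegrable_le _ hi); first exact: measurable_powRn.
  by move=> w; rewrite ger0_norm ?powR_ge0.
apply/LboundP => //; split => //.
- by move=> w; rewrite mulr_ge0.
- by rewrite mulr_ge0// ltW.
apply: le_trans (Ex_le fgi hi key) _.
rewrite ExD ?ExZ//; [|exact: rintegrableZ|exact: rintegrableZ].
rewrite (powRM _ (ltW a0) (ltW b0)) -/A -/B.
have fa' : Ex P (fun w => f w `^ (2 * p)) <= A ^+ 2 by rewrite -(sq _ (ltW a0)).
have gb' : Ex P (fun w => g w `^ (2 * p)) <= B ^+ 2 by rewrite -(sq _ (ltW b0)).
have h1 : B / A / 2 * Ex P (fun w => f w `^ (2 * p)) <= B / A / 2 * A ^+ 2.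
  by apply: ler_wpM2l fa'; rewrite !divr_ge0// ltW.
have h2 : A / B / 2 * Ex P (fun w => g w `^ (2 * p)) <= A / B / 2 * B ^+ 2.
  by apply: ler_wpM2l gb'; rewrite !divr_ge0// ltW.
apply: (le_trans (lerD h1 h2)); rewrite le_eqVlt; apply/orP; left; apply/eqP.
by field; rewrite !gt_eqF.
Qed.

(** Hoelder's inequality for p, p/(p-2), p: [young3_powR] is applied to f/a, s/v, g/b, so that each
    normalised p-th moment is at most 1 and the weights 1, p - 2, 1 add up to p. *)
Lemma hoelder3 p f s g a v b : 2 <= p -> 0 < a -> 0 < v -> 0 < b ->
  Lbound p f a -> Lbound p s v -> Lbound p g b ->
  rintegrable (fun w => f w * s w `^ (p - 2) * g w) /\
  Ex P (fun w => f w * s w `^ (p - 2) * g w) <= a * v `^ (p - 2) * b.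
Proof.
move=> p2 a0 v0 b0; have p0 : 0 < p by lra.
move=> /(LboundP _ _ p0)[mf f0 _ fi fa] /(LboundP _ _ p0)[ms s0 _ si sv]
  /(LboundP _ _ p0)[mg g0 _ gi gb].
pose c := a * v `^ (p - 2) * b.
have c0 : 0 < c by rewrite !mulr_gt0 ?powR_gt0.
pose A := a `^ p; pose V := v `^ p; pose B := b `^ p.
have A0 : 0 < A by rewrite powR_gt0.
have V0 : 0 < V by rewrite powR_gt0.
have B0 : 0 < B by rewrite powR_gt0.
have key w : f w * s w `^ (p - 2) * g w <=
    c / p * (A^-1 * f w `^ p + ((p - 2) / V * s w `^ p + B^-1 * g w `^ p)).
  have := @young3_powR R p (f w / a) (s w / v) (g w / b) p2
    (divr_ge0 (f0 w) (ltW a0)) (divr_ge0 (s0 w) (ltW v0)) (divr_ge0 (g0 w) (ltW b0)).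
  have pd x y q : 0 <= x -> 0 < y -> (x / y) `^ q = x `^ q / y `^ q.
    by move=> x0 y0; rewrite powRM ?invr_ge0 ?(ltW y0)// -powRN -[y^-1]powR_inv1 ?(ltW y0)// -powRrM mulN1r.
  rewrite !pd// -/A -/V -/B => h.
  have vp : 0 < v `^ (p - 2) by rewrite powR_gt0.
  rewrite -(ler_pM2l p0).
  have -> : p * (f w * s w `^ (p - 2) * g w) =
     c * (p * (f w / a * (s w `^ (p - 2) / v `^ (p - 2)) * (g w / b))).
    by rewrite /c; field; rewrite !gt_eqF.
  have -> : p * (c / p * (A^-1 * f w `^ p + ((p - 2) / V * s w `^ p + B^-1 * g w `^ p))) =
     c * (f w `^ p / A + (p - 2) * (s w `^ p / V) + g w `^ p / B).
    by field; rewrite !gt_eqF.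
  by rewrite ler_pM2l.
have i1 : rintegrable (fun w => (p - 2) / V * s w `^ p + B^-1 * g w `^ p).
  by apply/rintegrableD; exact: rintegrableZ.
have i2 : rintegrable (fun w => A^-1 * f w `^ p + ((p - 2) / V * s w `^ p + B^-1 * g w `^ p)).
  by apply/rintegrableD => //; exact: rintegrableZ.
have hi := rintegrableZ (c / p) i2.
have fgi : rintegrable (fun w => f w * s w `^ (p - 2) * g w).
  apply: (rintegrable_le _ hi).
    by apply: measurable_funM => //; apply: measurable_funM => //; exact: measurable_powRn.
  by move=> w; rewrite ger0_norm// !mulr_ge0 ?powR_ge0.
split => //; apply: le_trans (Ex_le fgi hi key) _.
rewrite !(ExZ, ExD)//; try exact: rintegrableZ.
rewrite -/c -[leRHS](_ : c / p * (1 + ((p - 2) + 1)) = c); last by field; rewrite gt_eqF.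
rewrite ler_wpM2l ?divr_ge0 ?(ltW c0) ?(ltW p0)//.
have h1 : A^-1 * Ex P (fun w => f w `^ p) <= 1 by rewrite ler_pdivrMl// mulr1.
have h3 : B^-1 * Ex P (fun w => g w `^ p) <= 1 by rewrite ler_pdivrMl// mulr1.
rewrite lerD// lerD//.
rewrite -mulrA ler_piMr ?subr_ge0//.
by rewrite ler_pdivrMl// mulr1.
Qed.

End RealExpectation.

(** * Measurability with respect to a sub-sigma-algebra *)

Section SubSigmaMeasurability.
Context {R : realType} {d : measure_display} {T : measurableType d}.
Variable G : set (set T).
Hypothesis sG : sigma_algebra setT G.
Implicit Types f g : T -> R.

(** Passing to [g_sigma_algebraType G], whose measurable sets are exactly those of [G], makes the
    closure properties of measurable functions available for a sub-sigma-algebra. *)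
Lemma GmeasurableP f : Gmeasurable G f <->
  measurable_fun setT (f : g_sigma_algebraType G -> R).
Proof.
have GE : (measurable : set (set (g_sigma_algebraType G))) = G.
  exact: measurable_g_measurableTypeE.
split=> [mf _ B mB|mf B mB].
  by rewrite setTI GE; exact: mf.
by have := mf measurableT B mB; rewrite setTI GE.
Qed.

Lemma Gmeas_cst (c : R) : Gmeasurable G (fun=> c).
Proof. by apply/GmeasurableP; exact: measurable_cst. Qed.

Lemma GmeasD f g : Gmeasurable G f -> Gmeasurable G g ->
  Gmeasurable G (fun w => f w + g w).
Proof. by move=> /GmeasurableP mf /GmeasurableP mg; apply/GmeasurableP; exact: measurable_funD. Qed.

Lemma GmeasM f g : Gmeasurable G f -> Gmeasurable G g ->
  Gmeasurable G (fun w => f w * g w).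
Proof. by move=> /GmeasurableP mf /GmeasurableP mg; apply/GmeasurableP; exact: measurable_funM. Qed.

Lemma Gmeas_comp (h : R -> R) f : measurable_fun setT h -> Gmeasurable G f ->
  Gmeasurable G (fun w => h (f w)).
Proof. by move=> mh /GmeasurableP mf; apply/GmeasurableP; exact: measurableT_comp. Qed.

Lemma Gmeas_sum (J : Type) (r : seq J) (Q : pred J) (F : J -> T -> R) :
  (forall j, Q j -> Gmeasurable G (F j)) ->
  Gmeasurable G (fun w => \sum_(j <- r | Q j) F j w).
Proof.
move=> mF; elim: r => [|j r IH].
  rewrite (_ : (fun w => _) = fun=> 0); first exact: Gmeas_cst.
  by apply/funext => w; rewrite big_nil.
have [Qj|Qj] := boolP (Q j).
  rewrite (_ : (fun w => _) = fun w => F j w + \sum_(j <- r | Q j) F j w).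
    by apply: GmeasD => //; exact: mF.
  by apply/funext => w; rewrite big_cons Qj.
rewrite (_ : (fun w => _) = fun w => \sum_(j <- r | Q j) F j w)//.
by apply/funext => w; rewrite big_cons (negPf Qj).
Qed.

Lemma GmeasZ (a : R) f : Gmeasurable G f -> Gmeasurable G (fun w => a * f w).
Proof. by move=> mf; apply: GmeasM mf; exact: Gmeas_cst. Qed.

Lemma GmeasB f g : Gmeasurable G f -> Gmeasurable G g ->
  Gmeasurable G (fun w => f w - g w).
Proof.
move=> mf /(GmeasZ (-1)) mg.
rewrite (_ : (fun w => _) = fun w => f w + -1 * g w); first exact: GmeasD.
by apply/funext => w; rewrite mulN1r.
Qed.

Lemma Gmeas_nrm (I : finType) (X : T -> I -> R) :
  (forall i, Gmeasurable G (fun w => X w i)) ->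
  Gmeasurable G (fun w => nrm (X w)).
Proof.
move=> mX; apply: Gmeas_comp.
  by apply: continuous_measurable_fun => x; exact: sqrt_continuous.
by apply: Gmeas_sum => i _; rewrite /=; under eq_fun do rewrite expr2; exact: GmeasM.
Qed.

Lemma Gmeas_powgrad (I : finType) p (X : T -> I -> R) :
  (forall i, Gmeasurable G (fun w => X w i)) ->
  forall i, Gmeasurable G (fun w => powgrad p (X w) i).
Proof.
move=> mX i; apply: GmeasM => //.
apply: (@Gmeas_comp (fun x => x `^ (p - 2))); first exact: measurable_powR.
exact: Gmeas_nrm.
Qed.

Lemma Gmeas_measurable f : G `<=` measurable -> Gmeasurable G f ->
  measurable_fun setT f.
Proof. by move=> sub mf _ B mB; rewrite setTI; exact/sub/mf. Qed.

End SubSigmaMeasurability.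

Section MeasurableNorm.
Context {R : realType} {d : measure_display} {T : measurableType d}.

Lemma sigma_algebra_measurable_setT : sigma_algebra setT (@measurable d T).
Proof. exact: sigma_algebra_measurable. Qed.

Lemma GmeasurableT (f : T -> R) : Gmeasurable measurable f <-> measurable_fun setT f.
Proof.
split=> [mf _ B mB|mf B mB]; first by rewrite setTI; exact: mf.
by have := mf measurableT B mB; rewrite setTI.
Qed.

Lemma measurable_nrm (I : finType) (X : T -> I -> R) :
  (forall i, measurable_fun setT (fun w => X w i)) ->
  measurable_fun setT (fun w => nrm (X w)).
Proof.
move=> mX; apply: (GmeasurableT _).1.
apply: (Gmeas_nrm sigma_algebra_measurable_setT) => i.
exact: (GmeasurableT _).2 (mX i).
Qed.

End MeasurableNorm.

(** * Independence and equality in law of pairs *)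

Section JointLaws.
Context {R : realType} {d : measure_display} {T : measurableType d}.
Variable P : probability T R.
Implicit Types f g : T -> R.

Let mfunpack f (mf : measurable_fun setT f) : {mfun T >-> R} :=
  MeasurableFun.Pack (MeasurableFun.Class (isMeasurableFun.Build _ _ _ _ _ mf)).

Let pairpack f g (mf : measurable_fun setT f) (mg : measurable_fun setT g) :
    {mfun T >-> (R * R)%type} :=
  MeasurableFun.Pack (MeasurableFun.Class
    (isMeasurableFun.Build _ _ _ _ _ (measurable_fun_pair mf mg))).

Let emul (z : R * R) : \bar R := (z.1 * z.2)%:E.

Let memul : measurable_fun setT emul.
Proof.
by apply/measurable_EFinP/measurable_funM; [exact: measurable_fst|exact: measurable_snd].
Qed.

(** On rectangles the joint law agrees with the product of the marginals, hence everywhere; Fubini's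
    theorem then factors the integral of the coordinate product. *)
Lemma Ex_indep f g :
  (forall A B, measurable A -> measurable B ->
    P (f @^-1` A `&` g @^-1` B) = (P (f @^-1` A) * P (g @^-1` B))%E) ->
  rintegrable P f -> rintegrable P g -> rintegrable P (fun w => f w * g w) ->
  Ex P (fun w => f w * g w) = Ex P f * Ex P g.
Proof.
move=> ind fi gi fgi.
have mf := rintegrable_meas fi; have mg := rintegrable_meas gi.
pose D1 := distribution P (mfunpack mf).
pose D2 := distribution P (mfunpack mg).
pose D := distribution P (pairpack mf mg).
have DE : forall A, measurable A -> (D1 \x D2)%E A = D A.
  by apply: product_measure_unique => A B mA mB; exact: ind.
have Di : D.-integrable setT emul by exact: integrable_pushforward.
have Di' : ((D1 \x D2)%E : {measure set _ -> \bar R}).-integrable setT emul.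
  apply/integrableP; split => //.
  have [_] := integrableP _ _ _ Di; apply: le_lt_trans.
  by rewrite (eq_measure_integral D)// => A mA _; exact: DE.
have i1 : D1.-integrable setT (EFin : R -> \bar R).
  by apply: integrable_pushforward => //; exact/measurable_EFinP.
have i2 : D2.-integrable setT (EFin : R -> \bar R).
  by apply: integrable_pushforward => //; exact/measurable_EFinP.
apply: EFin_inj; rewrite EFin_Ex//.
have -> : (\int[P]_w (f w * g w)%:E = \int[D]_z emul z)%E.
  by rewrite integral_pushforward.
have -> : (\int[D]_z emul z = \int[(D1 \x D2)%E]_z emul z)%E.
  by apply: eq_measure_integral => A mA _; exact: esym (DE A mA).
rewrite -(integral12_prod_meas1 Di').
have e2 : (\int[D2]_y y%:E = (Ex P g)%:E)%E.
  by rewrite EFin_Ex// integral_pushforward//; exact/measurable_EFinP.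
have e1 : (\int[D1]_y y%:E = (Ex P f)%:E)%E.
  by rewrite EFin_Ex// integral_pushforward//; exact/measurable_EFinP.
have inner x : fubini_F D2 emul x = ((Ex P g)%:E * x%:E)%E.
  transitivity (\int[D2]_y (x%:E * y%:E))%E; first by [].
  by rewrite integralZl// e2 muleC.
under eq_integral do rewrite inner.
by rewrite integralZl// e1 muleC EFinM.
Qed.

(** Rectangles form a generating class stable under intersections, so they determine the law of the
    pair. *)
Lemma eq_Ex_joint f g f' g' :
  (forall A B, measurable A -> measurable B ->
    P (f @^-1` A `&` g @^-1` B) = P (f' @^-1` A `&` g' @^-1` B)) ->
  rintegrable P (fun w => f w * g w) -> rintegrable P (fun w => f' w * g' w) ->
  measurable_fun setT f -> measurable_fun setT g ->
  measurable_fun setT f' -> measurable_fun setT g' ->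
  Ex P (fun w => f w * g w) = Ex P (fun w => f' w * g' w).
Proof.
move=> eqP' fgi fgi' mf mg mf' mg'.
pose D := distribution P (pairpack mf mg).
pose D' := distribution P (pairpack mf' mg').
pose C : set (set (R * R)) :=
  [set A `*` B | A in measurable & B in measurable].
have DE : forall A, measurable A -> D A = D' A.
  move=> A mA; apply: (@measure_unique _ _ _ C (fun=> setT)) => //.
  - by rewrite measurable_prod_measurableType.
  - move=> _ _ [X1 mX1 [X2 mX2 <-]] [Y1 mY1 [Y2 mY2 <-]].
    rewrite -setXI; exists (X1 `&` Y1); first exact: measurableI.
    by exists (X2 `&` Y2) => //; exact: measurableI.
  - by move=> _; exists setT => //; exists setT => //; rewrite setXTT.
  - by rewrite bigcup_const//; exists 0%N.
  - by move=> _ [X mX [Y mY <-]]; exact: eqP'.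
  - by move=> _; rewrite [ltLHS](_ : _ = 1%E) ?ltry//; exact: (probability_setT D).
apply: EFin_inj; rewrite !EFin_Ex//.
have -> : (\int[P]_w (f w * g w)%:E = \int[D]_z emul z)%E.
  by rewrite integral_pushforward.
have -> : (\int[P]_w (f' w * g' w)%:E = \int[D']_z emul z)%E.
  by rewrite integral_pushforward.
by rewrite (eq_measure_integral D')// => A mA _; exact: DE.
Qed.

End JointLaws.

(** * Random vectors and their orthogonality to independent centred ones *)

Section VectorMoments.
Context {R : realType} {d : measure_display} {T : measurableType d}.
Variable P : probability T R.
Context {I : finType}.
Implicit Types (X Y W Z : T -> I -> R) (p : R).

Definition vmeas X := forall i, measurable_fun setT (fun w => X w i).

Lemma Lbound_young p f g a b : 1 <= p -> Lbound P p f a -> Lbound P p g b ->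
  rintegrable P (fun w => f w `^ (p - 1) * g w).
Proof.
move=> p1 fa gb; have p0 : 0 < p by lra.
have fi := Lbound_rintegrable p0 fa; have gi := Lbound_rintegrable p0 gb.
case: fa => mf f0 _ _; case: gb => mg g0 _ _.
have h : rintegrable P (fun w => p^-1 * ((p - 1) * f w `^ p + g w `^ p)).
  by apply/rintegrableZ/rintegrableD => //; exact: rintegrableZ.
apply: (rintegrable_le _ h).
  by apply: measurable_funM => //; exact: measurable_powRn.
move=> w; rewrite ger0_norm ?mulr_ge0 ?powR_ge0//.
by rewrite ler_pdivlMl//; exact: young_powR.
Qed.

Lemma rintegrable_coordM X Y : vmeas X -> vmeas Y ->
  rintegrable P (fun w => nrm (X w) * nrm (Y w)) ->
  forall i, rintegrable P (fun w => X w i * Y w i).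
Proof.
move=> mX mY XY i; apply: (rintegrable_le _ XY); first exact: measurable_funM.
by move=> w; rewrite normrM ler_pM ?normr_ge0 ?nrm_coord.
Qed.

Lemma rintegrable_dot X Y : vmeas X -> vmeas Y ->
  rintegrable P (fun w => nrm (X w) * nrm (Y w)) ->
  rintegrable P (fun w => dot (X w) (Y w)).
Proof. by move=> mX mY XY; apply: rintegrable_sum => i _; exact: rintegrable_coordM. Qed.

Lemma rintegrable_coord X : vmeas X -> rintegrable P (fun w => nrm (X w)) ->
  forall i, rintegrable P (fun w => X w i).
Proof.
by move=> mX iX i; apply: (rintegrable_le (mX i) iX) => w; exact: nrm_coord.
Qed.

Lemma vmeas_powgrad p X : vmeas X -> vmeas (fun w => powgrad p (X w)).
Proof.
move=> mX i; apply: (GmeasurableT _).1.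
apply: (Gmeas_powgrad sigma_algebra_measurable_setT) => j.
exact: (GmeasurableT _).2 (mX j).
Qed.

Lemma rintegrable_dot_powgrad p X Y a b : 2 <= p -> vmeas X -> vmeas Y ->
  Lbound P p (fun w => nrm (X w)) a -> Lbound P p (fun w => nrm (Y w)) b ->
  rintegrable P (fun w => dot (powgrad p (X w)) (Y w)).
Proof.
move=> p2 mX mY Xa Yb; apply: rintegrable_dot => //; first exact: vmeas_powgrad.
have := Lbound_young _ Xa Yb => /(_ (ltac:(lra))); apply: rintegrable_eq => w.
by rewrite nrm_powgrad.
Qed.

Lemma Lbound_nrmD p X Y a b : 1 <= p -> vmeas X -> vmeas Y ->
  Lbound P p (fun w => nrm (X w)) a -> Lbound P p (fun w => nrm (Y w)) b ->
  Lbound P p (fun w => nrm (fun i => X w i + Y w i)) (a + b).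
Proof.
move=> p1 mX mY Xa Yb; apply: (Lbound_le _ _ _ _ (LboundD p1 Xa Yb)).
- lra.
- by apply: measurable_nrm => i; exact: measurable_funD.
- by move=> w; exact: nrm_ge0.
- by move=> w; exact: nrmD.
Qed.

Lemma Lbound_nrmB p X Y a b : 1 <= p -> vmeas X -> vmeas Y ->
  Lbound P p (fun w => nrm (X w)) a -> Lbound P p (fun w => nrm (Y w)) b ->
  Lbound P p (fun w => nrm (fun i => X w i - Y w i)) (a + b).
Proof.
move=> p1 mX mY Xa Yb; apply: (Lbound_le _ _ _ _ (LboundD p1 Xa Yb)).
- lra.
- by apply: measurable_nrm => i; exact: measurable_funB.
- by move=> w; exact: nrm_ge0.
- by move=> w; exact: nrmB.
Qed.

(** The mean vector [m] is tested against itself: |m|^2 = E <m, X> <= |m| E|X|. *)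
Lemma nrm_Ex_le X : vmeas X -> rintegrable P (fun w => nrm (X w)) ->
  nrm (fun i => Ex P (fun w => X w i)) <= Ex P (fun w => nrm (X w)).
Proof.
move=> mX iX; set m := fun i => _.
have Xi := rintegrable_coord mX iX.
have h : nrm m ^+ 2 <= nrm m * Ex P (fun w => nrm (X w)).
  rewrite -dotuu /dot {2}/m.
  under eq_bigr do rewrite -ExZ//.
  rewrite -Ex_sum; last by move=> i _; exact: rintegrableZ.
  rewrite -ExZ//; apply: Ex_le; [|exact: rintegrableZ|by move=> w; exact: dot_le].
  by apply: rintegrable_sum => i _; exact: rintegrableZ.
have [m0|m0] := eqVneq (nrm m) 0.
  rewrite m0 -[leLHS](Ex_cst P); apply: Ex_le => //; first exact: rintegrable_cst.
  by move=> w; exact: nrm_ge0.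
have mp : 0 < nrm m by rewrite lt_def m0 nrm_ge0.
by move: h; rewrite expr2 ler_pM2l.
Qed.

Lemma Lbound_center p X a : 1 <= p -> vmeas X ->
  Lbound P p (fun w => nrm (X w)) a ->
  Lbound P p (fun w => nrm (fun i => X w i - Ex P (fun w => X w i))) (2 * a).
Proof.
move=> p1 mX Xa; have [iX Ea] := Lbound_Ex p1 Xa.
have p0 : 0 < p by exact: lt_le_trans ltr01 p1.
have -> : 2 * a = a + a by rewrite mulr_natl mulr2n.
apply: (@Lbound_nrmB p X (fun=> fun i => Ex P (fun w => X w i)) _ _ p1 mX _ Xa).
  by move=> i; exact: measurable_cst.
apply: (Lbound_widen (le_trans (nrm_Ex_le mX iX) Ea)).
exact: (Lbound_cst _ p0 (nrm_ge0 _)).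
Qed.

Variables G H : set (set T).
Hypotheses (sG : sub_sigma G) (sH : sub_sigma H) (GH : indep_sigma P G H).

Let vmeasG X : (forall i, Gmeasurable G (fun w => X w i)) -> vmeas X.
Proof. by move=> mX i; apply: (Gmeas_measurable sG.2); exact: mX. Qed.

Let vmeasH X : (forall i, Gmeasurable H (fun w => X w i)) -> vmeas X.
Proof. by move=> mX i; apply: (Gmeas_measurable sH.2); exact: mX. Qed.

Lemma Ex_dot_powgrad_indep p X Z a b : 2 <= p ->
  (forall i, Gmeasurable G (fun w => X w i)) ->
  (forall i, Gmeasurable H (fun w => Z w i)) ->
  (forall i, Ex P (fun w => Z w i) = 0) ->
  Lbound P p (fun w => nrm (X w)) a -> Lbound P p (fun w => nrm (Z w)) b ->
  Ex P (fun w => dot (powgrad p (X w)) (Z w)) = 0.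
Proof.
move=> p2 mX mZ Z0 Xa Zb; have p1 : 1 <= p by apply: le_trans p2; rewrite ler1n.
have mX' := vmeasG mX; have mZ' := vmeasH mZ.
have mgX := vmeas_powgrad p mX'.
have igX : rintegrable P (fun w => nrm (powgrad p (X w))).
  have h1 : Lbound P p (fun=> (1 : R)) 1 by apply: Lbound_cst => //; lra.
  have := Lbound_young _ Xa h1 => /(_ (ltac:(lra))); apply: rintegrable_eq => w.
  by rewrite nrm_powgrad// mulr1.
have igZ : rintegrable P (fun w => nrm (powgrad p (X w)) * nrm (Z w)).
  have := Lbound_young _ Xa Zb => /(_ (ltac:(lra))); apply: rintegrable_eq => w.
  by rewrite nrm_powgrad.
have iZ : rintegrable P (fun w => nrm (Z w)).
  by have [] := Lbound_Ex p1 Zb.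
have ic := rintegrable_coordM mgX mZ' igZ.
rewrite Ex_sum; last by move=> i _; exact: ic.
rewrite big1// => i _; rewrite Ex_indep ?Z0 ?mulr0//.
- move=> A B mA mB; apply: GH; last exact: mZ.
  exact: (Gmeas_powgrad sG.1 p mX i).
- exact: (rintegrable_coord mgX).
- exact: rintegrable_coord.
Qed.

(** As [Z] is orthogonal to the gradient at [X], E|X|^p is the mean of the product of this gradient
    with X - Z. A vector close to a centred independent one must therefore be small itself. *)
Lemma Lbound_approx p X Z a b : 2 <= p ->
  (forall i, Gmeasurable G (fun w => X w i)) ->
  (forall i, Gmeasurable H (fun w => Z w i)) ->
  (forall i, Ex P (fun w => Z w i) = 0) ->
  Lbound P p (fun w => nrm (X w)) a ->
  Lbound P p (fun w => nrm (fun i => X w i - Z w i)) b ->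
  Lbound P p (fun w => nrm (X w)) b.
Proof.
move=> p2 mX mZ Z0 Xa XZb; have p1 : 1 <= p by apply: le_trans p2; rewrite ler1n.
have p0 : 0 < p by exact: lt_le_trans p1.
have mX' := vmeasG mX; have mZ' := vmeasH mZ.
have mXZ : vmeas (fun w i => X w i - Z w i) by move=> i; exact: measurable_funB.
have Zb : Lbound P p (fun w => nrm (Z w)) (a + b).
  apply: Lbound_eq (Lbound_nrmB p1 mX' mXZ Xa XZb).
  by move=> w; apply: eq_nrm => i; ring.
have E0 := Ex_dot_powgrad_indep p2 mX mZ Z0 Xa Zb.
have iX := Lbound_rintegrable p0 Xa.
have iXZ := Lbound_rintegrable p0 XZb.
have iY : rintegrable P (fun w => nrm (X w) `^ (p - 1) * nrm (fun i => X w i - Z w i)).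
  exact: (Lbound_young p1 Xa XZb).
have E1 : Ex P (fun w => nrm (X w) `^ p) =
    Ex P (fun w => dot (powgrad p (X w)) (fun i => X w i - Z w i)).
  rewrite -[LHS]subr0 -E0 -ExB//; last exact: (rintegrable_dot_powgrad p2 mX' mZ' Xa Zb).
  apply: eq_Ex => w; rewrite -dot_powgrad// /dot -sumrB.
  by apply: eq_bigr => i _; ring.
have E2 : Ex P (fun w => nrm (X w) `^ p) <=
    Ex P (fun w => nrm (X w) `^ (p - 1) * nrm (fun i => X w i - Z w i)).
  rewrite E1; apply: Ex_le => //.
    exact: (rintegrable_dot_powgrad p2 mX' mXZ Xa XZb).
  by move=> w; rewrite -nrm_powgrad//; exact: dot_le.
(* Young's inequality returns (p - 1) E|X|^p, which the left side absorbs, so that the constant in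
   the conclusion is 1. *)
have E3 : p * Ex P (fun w => nrm (X w) `^ (p - 1) * nrm (fun i => X w i - Z w i)) <=
    (p - 1) * Ex P (fun w => nrm (X w) `^ p)
    + Ex P (fun w => nrm (fun i => X w i - Z w i) `^ p).
  rewrite -!ExZ// -ExD//; last exact: rintegrableZ.
  apply: Ex_le; [exact: rintegrableZ|by apply: rintegrableD => //; exact: rintegrableZ|].
  by move=> w; apply: young_powR => //; exact: nrm_ge0.
apply/LboundP => //; split => //; [by case: Xa|by move=> w; exact: nrm_ge0|by case: XZb|].
apply: le_trans (Lbound_mean p0 XZb).
rewrite -(lerD2l ((p - 1) * Ex P (fun w => nrm (X w) `^ p))); apply: le_trans E3.
by rewrite -[X in _ * _ + X]mul1r -mulrDl subrK ler_pM2l.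
Qed.

(* Subtracting [Z] from [X] is free because [W] and [W'] are independent of the
   centred [Z]. *)
Lemma Ex_powgrad_diff p W W' X Z a u v b c : 2 <= p ->
  0 < a -> 0 < u -> 0 < v -> 0 < b ->
  (forall i, Gmeasurable G (fun w => W w i)) ->
  (forall i, Gmeasurable G (fun w => W' w i)) ->
  (forall i, Gmeasurable H (fun w => Z w i)) -> vmeas X ->
  (forall i, Ex P (fun w => Z w i) = 0) ->
  Lbound P p (fun w => nrm (fun i => W w i - W' w i)) a ->
  Lbound P p (fun w => nrm (W w)) u -> Lbound P p (fun w => nrm (W' w)) v ->
  Lbound P p (fun w => nrm (X w)) c ->
  Lbound P p (fun w => nrm (fun i => X w i - Z w i)) b ->
  Ex P (fun w => dot (powgrad p (W w)) (X w))
  - Ex P (fun w => dot (powgrad p (W' w)) (X w)) <=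
  (p - 1) * (a * b) * (u `^ (p - 2) + v `^ (p - 2)).
Proof.
move=> p2 a0 u0 v0 b0 mW mW' mZ mX Z0 WWa Wu W'v Xc XZb.
have p1 : 1 <= p by apply: le_trans p2; rewrite ler1n.
have mW1 := vmeasG mW; have mW1' := vmeasG mW'; have mZ1 := vmeasH mZ.
have mXZ : vmeas (fun w i => X w i - Z w i) by move=> i; exact: measurable_funB.
have Zb : Lbound P p (fun w => nrm (Z w)) (c + b).
  apply: Lbound_eq (Lbound_nrmB p1 mX mXZ Xc XZb).
  by move=> w; apply: eq_nrm => i; ring.
have red V e : (forall i, Gmeasurable G (fun w => V w i)) ->
    Lbound P p (fun w => nrm (V w)) e ->
    Ex P (fun w => dot (powgrad p (V w)) (X w)) =
    Ex P (fun w => dot (powgrad p (V w)) (fun i => X w i - Z w i)).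
  move=> mV Ve; have mV1 := vmeasG mV.
  rewrite -[LHS]subr0 -(Ex_dot_powgrad_indep p2 mV mZ Z0 Ve Zb) -ExB//.
  - apply: eq_Ex => w; rewrite /dot -sumrB.
    by apply: eq_bigr => i _; ring.
  - exact: rintegrable_dot_powgrad Ve Xc.
  - exact: rintegrable_dot_powgrad Ve Zb.
rewrite (red _ _ mW Wu) (red _ _ mW' W'v).
have i1 := rintegrable_dot_powgrad p2 mW1 mXZ Wu XZb.
have i2 := rintegrable_dot_powgrad p2 mW1' mXZ W'v XZb.
have [i3 h3] := hoelder3 p2 a0 u0 b0 WWa Wu XZb.
have [i4 h4] := hoelder3 p2 a0 v0 b0 WWa W'v XZb.
have i5 := rintegrableZ (p - 1) (rintegrableD i3 i4).
rewrite -ExB//; apply: (@le_trans _ _ (Ex P (fun w => (p - 1) *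
   (nrm (fun i => W w i - W' w i) * nrm (W w) `^ (p - 2) * nrm (fun i => X w i - Z w i) +
    nrm (fun i => W w i - W' w i) * nrm (W' w) `^ (p - 2) * nrm (fun i => X w i - Z w i))))).
  apply: Ex_le => //; first exact: rintegrableB.
  move=> w.
  have -> : dot (powgrad p (W w)) (fun i => X w i - Z w i) -
      dot (powgrad p (W' w)) (fun i => X w i - Z w i) =
      dot (fun i => powgrad p (W w) i - powgrad p (W' w) i) (fun i => X w i - Z w i).
    by rewrite /dot -sumrB; apply: eq_bigr => i _; ring.
  apply: le_trans (dot_le _ _) _.
  apply: (le_trans (ler_wpM2r (nrm_ge0 _) (powgrad_diff_le _ _ p2))).
  by rewrite le_eqVlt; apply/orP; left; apply/eqP; ring.
rewrite ExZ ?ExD//; last exact: rintegrableD.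
rewrite -mulrA ler_wpM2l ?subr_ge0//.
apply: (le_trans (lerD h3 h4)).
by rewrite le_eqVlt; apply/orP; left; apply/eqP; ring.
Qed.

End VectorMoments.

(** * The moment inequality for partial sums *)

Section StepInequalities.
Context {R : realFieldType}.
Implicit Types p v a Q x y : R.

(** Here 2 v a + a^2 <= (2 p + 1) a^2, and 2 p + 1 <= 8 (p - 1) for p >= 2. *)
Lemma large_step p v a Q : 2 <= p -> 0 <= a -> v <= p * a -> a ^+ 2 <= Q ->
  (v + a) ^+ 2 <= v ^+ 2 + 8 * (p - 1) * Q.
Proof.
move=> p2 a0 pa Qa.
have h1 : v * a <= p * a * a by rewrite ler_wpM2r.
have h2 : 8 * (p - 1) * a ^+ 2 <= 8 * (p - 1) * Q by rewrite ler_wpM2l//; lra.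
have h3 : 0 <= (6 * p - 9) * a ^+ 2 by rewrite mulr_ge0 ?sqr_ge0//; lra.
nra.
Qed.

Lemma perturbed_product e x y : 0 <= e -> e <= 1 -> 0 <= x -> 0 <= y ->
  (x + e) * (y + e) <= x * y + e * (x + y + 1).
Proof. by move=> e0 e1 x0 y0; nra. Qed.

End StepInequalities.

Section LMixingSums.
Context {R : realType} {d : measure_display} {T : measurableType d}.
Variable P : probability T R.
Context {I : finType}.
Variables (F Fp : nat -> set (set T)) (p : R).
Hypothesis p2 : 2 <= p.
Hypothesis sF : forall k, sub_sigma (F k).
Hypothesis sFp : forall k, sub_sigma (Fp k).
Hypothesis F_mono : forall j k, (j <= k)%N -> F j `<=` F k.
Hypothesis FFp : forall k, indep_sigma P (F k) (Fp k).
Variables (X : nat -> T -> I -> R) (Z : nat -> nat -> T -> I -> R).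
Hypothesis mX : forall k i, Gmeasurable (F k) (fun w => X k w i).
Hypothesis mZ : forall k j i, (j <= k)%N -> Gmeasurable (Fp j) (fun w => Z k j w i).
Hypothesis Z0 : forall k j i, (j <= k)%N -> Ex P (fun w => Z k j w i) = 0.

Definition psum n (w : T) (i : I) : R := \sum_(k < n) X k w i.

(** The square of the bound for the n-th partial sum; [A] bounds the increments and [B k j] the
    error of approximating the k-th increment from time j on. *)
Let var (A : nat -> R) (B : nat -> nat -> R) n : R :=
  8 * (p - 1) * \sum_(k < n) \sum_(j < k.+1) A j * B k j.

Let p0 : 0 < p. Proof. by apply: lt_le_trans p2. Qed.
Let p1 : 1 <= p. Proof. by apply: le_trans p2; rewrite ler1n. Qed.

Let mX' k : vmeas (X k).
Proof. by move=> i; apply: (Gmeas_measurable (sF k).2); exact: mX. Qed.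

Let mpsum n : vmeas (psum n).
Proof.
move=> i; rewrite /psum.
apply: (GmeasurableT _).1; apply: (Gmeas_sum sigma_algebra_measurable_setT) => k _.
exact: (GmeasurableT _).2 (mX' k i).
Qed.

Let GmX k n i : (k <= n)%N -> Gmeasurable (F n) (fun w => X k w i).
Proof. by move=> kn B mB; apply: (F_mono kn); exact: mX. Qed.

(** The sum [psum k] stops before [X k]. So [psum j] and [psum j.+1] are both measurable for [F j],
    and the gradient difference between them is independent of [Fp j]. *)
Let Gmpsum k n i : (k <= n.+1)%N -> Gmeasurable (F n) (fun w => psum k w i).
Proof.
move=> kn; apply: (Gmeas_sum (sF n).1) => j _; apply: GmX.
by rewrite -ltnS (leq_trans (ltn_ord j)).
Qed.

Let psumS n w i : psum n.+1 w i = psum n w i + X n w i.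
Proof. by rewrite /psum big_ord_recr. Qed.

(** Positive bounds are assumed because [hoelder3] divides by them. The induction is strong: the
    telescoped gradient visits all earlier partial sums, whose bounds are at most that of
    [psum n]. *)
Lemma psum_bound_pos (A : nat -> R) (B : nat -> nat -> R) :
  (forall k, 0 < A k) -> (forall k j, (j <= k)%N -> 0 < B k j) ->
  (forall k, Lbound P p (fun w => nrm (X k w)) (A k)) ->
  (forall k j, (j <= k)%N ->
     Lbound P p (fun w => nrm (fun i => X k w i - Z k j w i)) (B k j)) ->
  forall n, Lbound P p (fun w => nrm (psum n w)) (Num.sqrt (var A B n)).
Proof.
move=> A0 B0 XA XZB.
have q0 k : 0 < \sum_(j < k.+1) A j * B k j.
  rewrite big_ord_recr/= ltr_wpDl ?mulr_gt0 ?B0//.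
  by apply: sumr_ge0 => j _; rewrite ltW// mulr_gt0// B0// ltnW.
have varS k : var A B k.+1 = var A B k + 8 * (p - 1) * \sum_(j < k.+1) A j * B k j.
  by rewrite /var big_ord_recr/= mulrDr.
have pm1 : 0 < p - 1 by rewrite subr_gt0 (lt_le_trans _ p2)// ltr1n.
have c0 : 0 < 8 * (p - 1) by rewrite mulr_gt0.
have var0 : var A B 0 = 0 by rewrite /var big_ord0 mulr0.
have varm k n : (k <= n)%N -> var A B k <= var A B n.
  move=> /subnK <-; elim: (n - k)%N => // m IH.
  by rewrite addSn varS (le_trans IH)// lerDl mulr_ge0 ?(ltW (q0 _))// ltW.
have var_ge0 n : 0 <= var A B n by rewrite -var0 varm.
have psum0 w : nrm (psum 0 w) = 0.
  by rewrite -[RHS](@nrm0 R I); apply: eq_nrm => i; rewrite /psum big_ord0.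
elim/ltn_ind => -[_|n IH].
  rewrite var0 sqrtr0; apply: Lbound_eq (Lbound_cst _ p0 (lexx 0)) => w.
  by rewrite psum0.
set v := Num.sqrt (var A B n).
have v0 : 0 <= v by exact: sqrtr_ge0.
have v2 : v ^+ 2 = var A B n by rewrite sqr_sqrtr.
(* At lag 0 the increment is also bounded by its own approximation error, by [Lbound_approx], so a^2
   is at most the last term A n * B n n of [Q]. *)
pose a := Num.min (A n) (B n n).
have a0 : 0 < a by rewrite lt_min A0 B0.
have Xa : Lbound P p (fun w => nrm (X n w)) a.
  rewrite /a minEle; case: ifP => // _.
  by apply: (Lbound_approx (sF n) (sFp n) (@FFp n) p2 (@mX n) _ _ (XA n) (XZB n n (leqnn n)));
    [move=> i; exact: mZ|move=> i; exact: Z0].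
have Sv : Lbound P p (fun w => nrm (psum n w)) v by exact: IH.
have Sva : Lbound P p (fun w => nrm (psum n.+1 w)) (v + a).
  apply: Lbound_eq (Lbound_nrmD p1 (@mpsum n) (@mX' n) Sv Xa) => w.
  by apply: eq_nrm => i; rewrite psumS.
set Q := \sum_(j < n.+1) A j * B n j.
have Qa : a ^+ 2 <= Q.
  rewrite /Q big_ord_recr/= ler_wpDl//.
    by apply: sumr_ge0 => j _; rewrite ltW// mulr_gt0// B0// ltnW.
  by rewrite expr2 ler_pM ?(ltW a0)// ge_min lexx ?orbT.
(* If the increment is larger than [v / p], the triangle inequality suffices;
   otherwise the growth of E |S|^p is controlled to first order. *)
have [pa|pa] := leP (p * a) v; last first.
  apply: Lbound_widen Sva.
  rewrite -[leLHS]ger0_norm ?addr_ge0 ?(ltW a0)// -sqrtr_sqr ler_wsqrtr//.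
  rewrite varS -v2 -/Q.
  by apply: large_step => //; exact: ltW.
have vp : 0 < v by apply: lt_le_trans pa; rewrite mulr_gt0.
(* In this case a <= v / p, so [u] is an a priori bound for the new sum, and u^(p-2) <= 3
   v^(p-2). *)
pose u := v * (1 + p^-1).
have ip0 : 0 < p^-1 by rewrite invr_gt0.
have u0 : 0 < u by rewrite mulr_gt0// addr_gt0.
have vu : v <= u by rewrite ler_peMr// lerDl ltW.
have Su : Lbound P p (fun w => nrm (psum n.+1 w)) u.
  by apply: Lbound_widen Sva; rewrite /u mulrDr mulr1 lerD2l ler_pdivlMr// mulrC.
have Sj j : (j <= n)%N -> Lbound P p (fun w => nrm (psum j w)) v.
  move=> jn; have {}IH := IH j; apply: (Lbound_widen _ (IH _)) => //.
  by rewrite ler_wsqrtr// varm.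
have Sj1 j : (j <= n.+1)%N -> Lbound P p (fun w => nrm (psum j w)) u.
  by rewrite leq_eqVlt => /predU1P[->//|jn]; exact/(Lbound_widen vu)/Sj.
have idot j : (j <= n.+1)%N ->
    rintegrable P (fun w => dot (powgrad p (psum j w)) (X n w)).
  by move=> jn; exact: (rintegrable_dot_powgrad p2 (@mpsum j) (@mX' n) (Sj1 j jn) Xa).
have grad0 : Ex P (fun w => dot (powgrad p (psum 0 w)) (X n w)) = 0.
  rewrite -[RHS](Ex_cst P); apply: eq_Ex => w; rewrite /dot big1// => i _.
  by rewrite /powgrad /psum big_ord0 mulr0 mul0r.
have tele : Ex P (fun w => dot (powgrad p (psum n.+1 w)) (X n w)) =
    \sum_(j < n.+1) (Ex P (fun w => dot (powgrad p (psum j.+1 w)) (X n w))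
                   - Ex P (fun w => dot (powgrad p (psum j w)) (X n w))).
  rewrite -(big_mkord xpredT (fun j => Ex P (fun w => dot (powgrad p (psum j.+1 w)) (X n w))
                   - Ex P (fun w => dot (powgrad p (psum j w)) (X n w)))).
  by rewrite telescope_sumr// grad0 subr0.
have term (j : 'I_n.+1) : Ex P (fun w => dot (powgrad p (psum j.+1 w)) (X n w))
    - Ex P (fun w => dot (powgrad p (psum j w)) (X n w)) <=
    (p - 1) * (A j * B n j) * (u `^ (p - 2) + v `^ (p - 2)).
  have jn : (j <= n)%N by rewrite -ltnS.
  apply: (Ex_powgrad_diff (sF j) (sFp j) (@FFp j) p2 (A0 j) u0 vp (B0 n j jn) _ _ _ (@mX' n) _ _
     (Sj1 j.+1 jn) (Sj j jn) Xa (XZB n j jn)).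
  - by move=> i; exact: Gmpsum.
  - by move=> i; apply: Gmpsum; exact: ltnW.
  - by move=> i; exact: mZ.
  - by move=> i; exact: Z0.
  - apply: Lbound_eq (XA j) => w; apply: eq_nrm => i.
    by rewrite psumS addrC addKr.
have u3 : u `^ (p - 2) + v `^ (p - 2) <= 4 * v `^ (p - 2).
  rewrite /u powRM ?addr_ge0 ?(ltW ip0)//.
  rewrite [4 * _]mulrC (_ : 4 = 3 + 1); last by ring.
  rewrite mulrDr mulr1 lerD2r ler_wpM2l ?powR_ge0//.
  exact: powR_1Dinv_le3.
have sumb : Ex P (fun w => dot (powgrad p (psum n.+1 w)) (X n w)) <=
    (p - 1) * Q * (4 * v `^ (p - 2)).
  rewrite tele; apply: (le_trans (ler_sum _ (fun j _ => term j))).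
  rewrite -mulr_suml -mulr_sumr -/Q ler_wpM2l// mulr_ge0 ?(ltW pm1)//.
  exact: ltW (q0 n).
apply/LboundP => //; split; [by case: Su|by move=> w; exact: nrm_ge0|
  exact: sqrtr_ge0|exact: Lbound_rintegrable p0 Su|].
have iSn := Lbound_rintegrable p0 Sv.
have iSu := Lbound_rintegrable p0 Su.
apply: (@le_trans _ _ (v `^ p + p * ((p - 1) * Q * (4 * v `^ (p - 2))))).
  apply: (@le_trans _ _ (Ex P (fun w => nrm (psum n w) `^ p
                   + p * dot (powgrad p (psum n.+1 w)) (X n w)))).
    apply: Ex_le => //.
      by apply: rintegrableD => //; apply: rintegrableZ; exact: idot.
    move=> w; apply: le_trans (nrm_pow_convex (psum n.+1 w) (psum n w) p2) _.
    rewrite le_eqVlt; apply/orP; left; apply/eqP; congr (_ + _ * dot _ _).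
    by apply/funext => i; rewrite psumS addrC addKr.
  rewrite ExD ?ExZ//; [|exact: idot|by apply: rintegrableZ; exact: idot].
  by rewrite lerD ?(Lbound_mean p0 Sv)// ler_pM2l.
have v2p : v `^ p = v `^ (p - 2) * v ^+ 2.
  by rewrite -powR_mulrn// -powRD ?subrK// (gt_eqF vp) implybT.
(* With this [x] the target is v sqrt(1 + x). Bernoulli's inequality with exponent p/2 gives (1 +
   x)^(p/2) >= 1 + 4 p (p - 1) Q / v^2, exactly the first-order growth just obtained; hence 8 = 2 *
   4, with 4 = 3 + 1 from [u3]. *)
pose x := 8 * (p - 1) * Q / v ^+ 2.
have x0 : 0 <= x by rewrite divr_ge0 ?sqr_ge0// mulr_ge0 ?(ltW c0)// ltW// q0.
have vN0 : v != 0 by rewrite gt_eqF.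
have -> : Num.sqrt (var A B n.+1) = v * Num.sqrt (1 + x).
  rewrite -[v]ger0_norm// -sqrtr_sqr -sqrtrM ?sqr_ge0// varS -v2 -/Q.
  by congr Num.sqrt; rewrite /x; field.
rewrite powRM ?sqrtr_ge0//.
have -> : Num.sqrt (1 + x) `^ p = (1 + x) `^ (p / 2).
  by rewrite -powR12_sqrt ?addr_ge0// -powRrM mulrC.
have half : 1 <= p / 2 by rewrite ler_pdivlMr// mul1r.
have := ler_wpM2l (powR_ge0 v p) (bernoulli_powR half x0).
apply: le_trans; rewrite v2p /x le_eqVlt; apply/orP; left; apply/eqP.
by field.
Qed.

Theorem psum_bound (A : nat -> R) (B : nat -> nat -> R) n :
  (forall k, Lbound P p (fun w => nrm (X k w)) (A k)) ->
  (forall k j, (j <= k)%N ->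
     Lbound P p (fun w => nrm (fun i => X k w i - Z k j w i)) (B k j)) ->
  Lbound P p (fun w => nrm (psum n w))
    (Num.sqrt (8 * (p - 1) * \sum_(k < n) \sum_(j < k.+1) A j * B k j)).
Proof.
move=> XA XZB; rewrite -/(var A B n).
have A0 k : 0 <= A k by case: (XA k).
have B0 k j : (j <= k)%N -> 0 <= B k j by move=> jk; case: (XZB k j jk).
pose C : R := \sum_(k < n) \sum_(j < k.+1) (A j + B k j + 1).
have C0 : 0 <= C.
  apply: sumr_ge0 => k _; apply: sumr_ge0 => j _.
  by rewrite !addr_ge0// B0// -ltnS.
have c0 : 0 <= 8 * (p - 1).
  by rewrite mulr_ge0// subr_ge0.
have v0 : 0 <= var A B n.
  rewrite mulr_ge0//; apply: sumr_ge0 => k _; apply: sumr_ge0 => j _.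
  by rewrite mulr_ge0// B0// -ltnS.
apply: (@Lbound_closed _ _ _ _ _ _ _ (Num.sqrt (8 * (p - 1) * C))).
- exact: sqrtr_ge0.
- exact: sqrtr_ge0.
move=> e e0 e1.
(* The shift is e^2 because it enters under a square root: sqrt(V + e^2 W) <= sqrt V + e sqrt W. *)
have e20 : 0 < e ^+ 2 by rewrite exprn_gt0.
have := @psum_bound_pos (fun k => A k + e ^+ 2) (fun k j => B k j + e ^+ 2) _ _ _ _ n.
move=> /(_ (fun k => ltr_wpDl (A0 k) e20) (fun k j jk => ltr_wpDl (B0 k j jk) e20)).
move=> H; apply: Lbound_widen (H _ _); last first.
- by move=> k j jk; apply: (Lbound_widen _ (XZB k j jk)); rewrite lerDl ltW.
- by move=> k; apply: (Lbound_widen _ (XA k)); rewrite lerDl ltW.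
have s0 : 0 <= Num.sqrt (var A B n) + e * Num.sqrt (8 * (p - 1) * C).
  by rewrite addr_ge0 ?sqrtr_ge0// mulr_ge0 ?sqrtr_ge0// ltW.
rewrite -[leRHS]ger0_norm// -sqrtr_sqr ler_wsqrtr//.
apply: (@le_trans _ _ (var A B n + e ^+ 2 * (8 * (p - 1) * C))); last first.
  rewrite sqrrD exprMn (sqr_sqrtr v0) (sqr_sqrtr (mulr_ge0 c0 C0)).
  rewrite lerD2r lerDl mulrn_wge0//.
  by rewrite !mulr_ge0 ?sqrtr_ge0// ltW.
rewrite /var [e ^+ 2 * _]mulrCA -mulrDr ler_wpM2l//.
rewrite mulr_sumr -big_split/=; apply: ler_sum => k _.
rewrite mulr_sumr -big_split/=; apply: ler_sum => j _.
apply: perturbed_product; rewrite ?sqr_ge0 ?exprn_ile1 ?(ltW e0)//.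
by rewrite B0// -ltnS.
Qed.

End LMixingSums.

(** * Summing lags and counting windows *)

Section IndexSums.
Context {R : realType}.

(** Schur's test: c_j c_k <= (c_j^2 + c_k^2) / 2, and both the row sums and the column sums of g(k -
    j) are at most [Gm]. *)
Lemma conv_sum_le (c g : nat -> R) (Gm : R) n :
  (forall k, 0 <= g k) -> (forall N, \sum_(t < N) g t <= Gm) ->
  \sum_(k < n) \sum_(j < k.+1) c j * (c k * g (k - j)%N) <=
  Gm * \sum_(k < n) c k ^+ 2.
Proof.
move=> g0 gG.
have h1 : \sum_(k < n) \sum_(j < k.+1) c k ^+ 2 * g (k - j)%N <=
    Gm * \sum_(k < n) c k ^+ 2.
  rewrite mulr_sumr; apply: ler_sum => k _.
  rewrite -mulr_sumr mulrC ler_wpM2r ?sqr_ge0//.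
  apply: le_trans (gG k.+1); rewrite le_eqVlt; apply/orP; left; apply/eqP.
  by rewrite (reindex_inj rev_ord_inj)/=; apply: eq_bigr => j _; rewrite subSS subKn// -ltnS.
have h2 : \sum_(k < n) \sum_(j < k.+1) c j ^+ 2 * g (k - j)%N <=
    Gm * \sum_(k < n) c k ^+ 2.
  have -> : \sum_(k < n) \sum_(j < k.+1) c j ^+ 2 * g (k - j)%N =
      \sum_(j < n) \sum_(k < n | (j <= k)%N) c j ^+ 2 * g (k - j)%N.
    rewrite (exchange_big_dep xpredT)//=; apply: eq_bigr => k _.
    by rewrite (big_ord_widen n (fun j => c j ^+ 2 * g (k - j)%N)).
  rewrite mulr_sumr; apply: ler_sum => j _.
  rewrite -mulr_sumr mulrC ler_wpM2r ?sqr_ge0//.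
  apply: le_trans (gG (n - j)%N); rewrite le_eqVlt; apply/orP; left; apply/eqP.
  rewrite -(big_mkord (fun k => (j <= k)%N) (fun k => g (k - j)%N)).
  rewrite -(big_mkord xpredT g) big_mkcond/=.
  rewrite (big_cat_nat (n := j))//=; last exact: ltnW.
  rewrite big_nat_cond big1 ?add0r; last first.
    by move=> i /andP[/andP[_ ij] _]; rewrite leqNgt ij.
  rewrite -[X in \sum_(X <= _ < _) _](add0n j) big_addn; apply: eq_big_nat => i _.
  by rewrite leq_addl addnK.
have h3 : \sum_(k < n) \sum_(j < k.+1) c j * (c k * g (k - j)%N) <=
    2^-1 * (\sum_(k < n) \sum_(j < k.+1) c k ^+ 2 * g (k - j)%N
          + \sum_(k < n) \sum_(j < k.+1) c j ^+ 2 * g (k - j)%N).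
  rewrite -big_split/= mulr_sumr; apply: ler_sum => k _.
  rewrite -big_split/= mulr_sumr; apply: ler_sum => j _.
  have := mulr_ge0 (sqr_ge0 (c j - c k)) (g0 (k - j)%N).
  by move: (c j) (c k) (g _) => x y z; nra.
by apply: (le_trans h3); rewrite mulrC ler_pdivrMr// mulr_natr mulr2n lerD.
Qed.

Definition cover (K M m l : nat) : nat :=
  #|[pred i : 'I_m | (i * K <= l < i * K + M)%N]|.

(** A window i that contains l starts at most M - 1 before it, so 0 <= l / K - i <= (M - 1) / K with
    integer quotients, and i is recovered from l / K - i. *)
Lemma cover_le K M m l : (0 < K)%N -> (0 < M)%N -> (cover K M m l <= ((M - 1) %/ K).+1)%N.
Proof.
move=> K0 M0; pose f (i : 'I_m) : 'I_((M - 1) %/ K).+1 := inord (l %/ K - i).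
have fv (i : 'I_m) : (i * K <= l < i * K + M)%N ->
    ((l %/ K - i)%N < ((M - 1) %/ K).+1)%N /\ (i <= l %/ K)%N.
  move=> /andP[il li]; have iK : (i <= l %/ K)%N by rewrite leq_divRL.
  split=> //; rewrite ltnS leq_divRL// mulnBl.
  have := leq_trunc_div l K; lia.
rewrite /cover -(card_in_imset (f := f)).
  by rewrite -[leqRHS](card_ord ((M - 1) %/ K).+1) max_card.
move=> i j; rewrite !inE => /fv[fi li] /fv[fj lj] /(congr1 val).
rewrite /f /= !inordK// => h; apply/val_inj => /=; lia.
Qed.

Lemma window_sum (K M m : nat) (G : nat -> R) :
  \sum_(i < m) \sum_(k < M) G (i * K + k)%N =
  \sum_(l < m * K + M) (cover K M m l)%:R * G l.
Proof.
have e (i : 'I_m) : \sum_(k < M) G (i * K + k)%N =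
    \sum_(l < m * K + M | (i * K <= l < i * K + M)%N) G l.
  have iN : (i * K + M <= m * K + M)%N by rewrite leq_add2r leq_mul2r ltnW ?orbT.
  rewrite -(big_mkord xpredT (fun k => G (i * K + k)%N)).
  rewrite -(big_mkord (fun l => i * K <= l < i * K + M)%N G).
  rewrite [RHS](big_cat_nat (n := (i * K + M)%N))//=.
  rewrite [X in _ + X]big_nat_cond [X in _ + X]big1 ?addr0; last first.
    by move=> l /andP[/andP[Ml _] /andP[_ lM]]; move: lM; rewrite ltnNge Ml.
  rewrite [RHS](big_cat_nat (n := (i * K)%N))//=; last exact: leq_addr.
  rewrite [X in _ = X + _]big_nat_cond [X in _ = X + _]big1 ?add0r; last first.
    by move=> l /andP[/andP[_ Ml] /andP[lM _]]; move: lM; rewrite leqNgt Ml.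
  rewrite -[X in _ = \sum_(X <= _ < _ | _) _]add0n big_addn addKn big_nat_cond [RHS]big_nat_cond.
  by apply: eq_big => [k|k _]; [rewrite leq_addl/=; lia|rewrite addnC].
under eq_bigr do rewrite e.
rewrite (exchange_big_dep xpredT)//=; apply: eq_bigr => l _.
rewrite sumr_const mulr_natl /cover; congr (_ *+ _); exact: eq_card.
Qed.

Lemma window_sum_le (K M m : nat) (G : nat -> R) : (0 < K)%N -> (0 < M)%N ->
  (forall l, 0 <= G l) ->
  \sum_(i < m) \sum_(k < M) G (i * K + k)%N <=
  ((M - 1) %/ K).+1%:R * \sum_(l < m * K + M) G l.
Proof.
move=> K0 M0 G0; rewrite window_sum mulr_sumr; apply: ler_sum => l _.
by rewrite ler_wpM2r// ler_nat cover_le.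
Qed.

(** The maximal multiplicity times the sum of all multiplicities, which is m M by [window_sum] for
    the constant 1. *)
Lemma sum_cover_sqr_le (K M m : nat) : (0 < K)%N -> (0 < M)%N ->
  \sum_(l < m * K + M) (cover K M m l)%:R ^+ 2 <=
  ((M - 1) %/ K).+1%:R * (m * M)%:R :> R.
Proof.
move=> K0 M0; have <- : \sum_(l < m * K + M) (cover K M m l)%:R = (m * M)%:R :> R.
  have := window_sum K M m (fun=> 1).
  under [in RHS]eq_bigr do rewrite mulr1.
  by move=> <-; rewrite !sumr_const !card_ord -mulrnA mulnC.
rewrite mulr_sumr; apply: ler_sum => l _; rewrite expr2 ler_wpM2r// ler_nat.
exact: cover_le.
Qed.

(** Each term telescopes: 1 / sqrt(k+1) <= 2 (sqrt(k+1) - sqrt k). *)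
Lemma sum_inv_sqrt_le k : \sum_(1 <= j < k) (Num.sqrt j%:R)^-1 <= 2 * Num.sqrt k%:R :> R.
Proof.
case: k => [|k]; first by rewrite big_geq// sqrtr0 mulr0.
apply: (@le_trans _ _ (2 * Num.sqrt k%:R)); last first.
  by rewrite ler_pM2l// ler_wsqrtr// ler_nat.
elim: k => [|k IH]; first by rewrite big_geq// sqrtr0 mulr0.
rewrite big_nat_recr//= (le_trans (lerD IH (lexx _)))//.
set x := Num.sqrt k%:R; set z := Num.sqrt k.+1%:R.
have z0 : 0 < z by rewrite sqrtr_gt0 ltr0n.
have x0 : 0 <= x by exact: sqrtr_ge0.
have zx : z ^+ 2 = x ^+ 2 + 1 by rewrite !sqr_sqrtr// -natr1.
rewrite -(ler_pM2l z0) mulrDr divff ?gt_eqF//.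
have := sqr_ge0 (z - x); nra.
Qed.

End IndexSums.

(** * Complex vectors and matrices in real coordinates *)

Section ComplexWeights.
Context {R : realType} {J : finType}.

(* The complex number [u + iv] acting on a real vector, in real coordinates:
   index [(a, false)] carries the real part, [(a, true)] the imaginary one. *)
Definition cscale (u v : R) (x : J -> R) : J * bool -> R :=
  fun ab => (if ab.2 then v else u) * x ab.1.

Lemma nrm_cscale u v x : nrm (cscale u v x) = Num.sqrt (u ^+ 2 + v ^+ 2) * nrm x.
Proof.
rewrite -sqrtrM ?addr_ge0 ?sqr_ge0//; congr Num.sqrt.
rewrite -(pair_bigA _ (fun a b => ((if b then v else u) * x a) ^+ 2))/= mulr_sumr.
by apply: eq_bigr => a _; rewrite big_bool/=; ring.
Qed.

End ComplexWeights.

Lemma sum_pairE (V : nmodType) (A B : finType) (f : A * B -> V) :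
  \sum_p f p = \sum_a \sum_b f (a, b).
Proof. by rewrite pair_bigA; apply: eq_bigr => -[a b]. Qed.

Section OuterProduct.
Context {R : realType} {J : finType}.
Implicit Types x y z : J * bool -> R.

(* The matrix [x y^*] of two complex vectors, in real coordinates. *)
Definition outer x y : J * J * bool -> R := fun abc =>
  let: (a, b, c) := abc in
  if c then x (a, true) * y (b, false) - x (a, false) * y (b, true)
  else x (a, false) * y (b, false) + x (a, true) * y (b, true).

Lemma nrm_pairE x : nrm x ^+ 2 = \sum_a (x (a, false) ^+ 2 + x (a, true) ^+ 2).
Proof.
rewrite nrm_sqr sum_pairE; apply: eq_bigr => a _.
by rewrite big_bool/= addrC.
Qed.

Lemma nrm_outer x y : nrm (outer x y) = nrm x * nrm y.
Proof.
rewrite -[RHS]ger0_norm ?mulr_ge0 ?nrm_ge0// -sqrtr_sqr; congr Num.sqrt.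
rewrite exprMn !nrm_pairE mulr_suml.
rewrite !sum_pairE; apply: eq_bigr => a _; rewrite mulr_sumr; apply: eq_bigr => b _.
by rewrite big_bool/=; ring.
Qed.

Lemma outerBB x y i : outer x x i - outer y y i =
  outer (fun j => x j - y j) x i + outer y (fun j => x j - y j) i.
Proof. by case: i => -[a b] []; rewrite /=; ring. Qed.

Lemma nrm_outerBB x y : nrm (fun i => outer x x i - outer y y i) <=
  nrm (fun j => x j - y j) * (nrm x + nrm y).
Proof.
rewrite (eq_nrm (outerBB x y)); apply: le_trans (nrmD _ _) _.
by rewrite !nrm_outer mulrDr [nrm y * _]mulrC.
Qed.

End OuterProduct.

(** * Numerical estimates behind the constants of the bound *)

Section ShiftedSums.
Context {R : realType}.

(** [C] stands for [c1], [S] for the square root of [Lf] and [r] for 1 / sqrt j, so that C S r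
    bounds the plug-in shift for j >= 1. As r <= 1, the quadratic part is at most of the order of
    the linear one, and 2 + 1 gives the 3. *)
Lemma cross_term_le (C S L r : R) : 0 <= C -> 0 <= r -> r <= 1 ->
  0 <= S -> S <= L -> S ^+ 2 = L ->
  C * S * r * (2 * C + C * S * r) <= 3 * C * (C * L) * r.
Proof.
move=> C0 r0 r1 S0 SL S2.
have -> : C * S * r * (2 * C + C * S * r) = C * C * r * (2 * S + S ^+ 2 * r) by ring.
have -> : 3 * C * (C * L) * r = C * C * r * (3 * L) by ring.
rewrite ler_wpM2l ?mulr_ge0// S2.
have : L * r <= L by rewrite ler_piMr// (le_trans S0).
lra.
Qed.

Lemma sum_shift_le (g : nat -> R) (Gm : R) m N : (forall k, 0 <= g k) ->
  (forall N, \sum_(t < N) g t <= Gm) ->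
  \sum_(l < N) (if (m <= l)%N then g (l - m)%N else 0) <= Gm.
Proof.
move=> g0 gG; apply: (@le_trans _ _ (\sum_(l < m + N) (if (m <= l)%N then g (l - m)%N else 0))).
  rewrite addnC big_split_ord/= lerDl; apply: sumr_ge0 => l _.
  by case: ifP.
rewrite big_split_ord/= big1 ?add0r; last by move=> l _; rewrite leqNgt ltn_ord.
by under eq_bigr do rewrite leq_addr addKn; exact: gG.
Qed.

Lemma sum_prefix_le (c : R) L N : 0 <= c ->
  \sum_(l < N) (if (l < L)%N then c else 0) <= L%:R * c.
Proof.
move=> c0; apply: (@le_trans _ _ (\sum_(l < L + N) (if (l < L)%N then c else 0))).
  rewrite addnC big_split_ord/= lerDl; apply: sumr_ge0 => l _.
  by case: ifP.
rewrite big_split_ord/= [X in _ + X]big1 ?addr0; last first.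
  by move=> l _; rewrite ltnNge leq_addr.
under eq_bigr do rewrite ltn_ord.
by rewrite sumr_const card_ord mulr_natl.
Qed.

(** [S] is sqrt k, [B] is [cc], [C] is [c1]; [A] is the constant of the main term and D m the
    contribution of j = 0. *)
Lemma rate_regroup (A B C D S k m : R) : 0 < S -> S ^+ 2 = k ->
  k^-1 * (A * S + (6 * C * B * S + D * m)) <=
  (A + 6 * C * B + 2 * B ^+ 2) / S + D * m / k.
Proof.
move=> S0 <-.
have -> : (A + 6 * C * B + 2 * B ^+ 2) / S + D * m / S ^+ 2 =
  (S ^+ 2)^-1 * (A * S + (6 * C * B * S + D * m)) + 2 * B ^+ 2 / S.
  by field; rewrite gt_eqF.
by rewrite lerDl divr_ge0 ?(ltW S0)// mulr_ge0 ?sqr_ge0.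
Qed.

End ShiftedSums.

(** * Moments of a stationary L-mixing process and of its weighted sums *)

Section StationaryLMixing.
Context {R : realType} {d : measure_display} {T : measurableType d}.
Variables (P : probability T R) (n : nat) (y : nat -> T -> 'cV[R]_n).
Variables (F Fp : nat -> set (set T)) (ce : nat -> nat -> T -> 'cV[R]_n).
Hypothesis sF : forall k, sub_sigma (F k).
Hypothesis sFp : forall k, sub_sigma (Fp k).
Hypothesis FS : forall k, F k `<=` F k.+1.
Hypothesis FFp : forall k, indep_sigma P (F k) (Fp k).
Hypothesis ceP : forall k tau, (tau <= k)%N ->
  condexp_version P (Fp (k - tau)%N) (y k) (ce k tau).
Hypothesis yS : stationary P y.
Hypothesis yL : Lmixing P F y ce.

Lemma filtration_mono j k : (j <= k)%N -> F j `<=` F k.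
Proof.
move=> /subnK <-; elim: (k - j)%N => // m IH; rewrite addSn.
exact: subset_trans IH (@FS _).
Qed.

Lemma LqE_ge0 q (f : T -> R) : (0 <= LqE P q f)%E.
Proof. exact: poweR_ge0. Qed.

Lemma Gmeas_y k a : Gmeasurable (F k) (fun w => y k w a 0).
Proof. by case: yL. Qed.

Lemma measurable_y k a : measurable_fun setT (fun w => y k w a 0).
Proof. exact: Gmeas_measurable (sF k).2 (@Gmeas_y k a). Qed.

Lemma Mr_fin q : 1 <= q -> Mq P q y = (Mr P y q)%:E.
Proof.
move=> q1; rewrite fineK// ge0_fin_numE; first by case: yL => _ /(_ q q1).
by apply: le_trans (LqE_ge0 q (fun w => vnorm (y 0 w))) _; apply: ereal_sup_ubound; exists 0%N.
Qed.

Lemma y_bound q k : 1 <= q ->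
  Lbound P q (fun w => nrm (fun a => y k w a 0)) (Mr P y q).
Proof.
move=> q1.
have h : (LqE P q (fun w => nrm (fun a => y k w a 0%R)) <= (Mr P y q)%:E)%E.
  by rewrite -Mr_fin//; apply: ereal_sup_ubound; exists k.
split => //; [|by move=> w; exact: nrm_ge0|].
  by apply: measurable_nrm => a; exact: measurable_y.
by rewrite -lee_fin; apply: le_trans h; exact: LqE_ge0.
Qed.

Definition gam q t : R := fine (gammaq P q y ce t).

Lemma gammaq_ge0 q t : (0 <= gammaq P q y ce t)%E.
Proof.
apply: le_trans (LqE_ge0 q (fun w => vnorm (y t w - ce t t w))) _.
by apply: ereal_sup_ubound; exists t => //=.
Qed.

Lemma gam_ge0 q t : 0 <= gam q t.
Proof. by rewrite fine_ge0// gammaq_ge0. Qed.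

Lemma Gr_fin q : 1 <= q -> Gammaq P q y ce = (Gr P y ce q)%:E.
Proof.
move=> q1; rewrite fineK// ge0_fin_numE; first by case: yL => _ _ /(_ q q1).
by apply: nneseries_ge0 => t _ _; exact: gammaq_ge0.
Qed.

Lemma gam_fin q t : 1 <= q -> gammaq P q y ce t = (gam q t)%:E.
Proof.
move=> q1; rewrite fineK// ge0_fin_numE ?gammaq_ge0//.
apply: (@le_lt_trans _ _ (Gammaq P q y ce)); last by case: yL => _ _ /(_ q q1).
apply: le_trans (nneseries_lim_ge t.+1 _); last by move=> i _ _; exact: gammaq_ge0.
rewrite big_nat_recr//= leeDr// sume_ge0// => i _; exact: gammaq_ge0.
Qed.

Lemma sum_gam_le q N : 1 <= q -> \sum_(t < N) gam q t <= Gr P y ce q.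
Proof.
move=> q1; rewrite -lee_fin -Gr_fin// -sumEFin.
under eq_bigr do rewrite -gam_fin//.
rewrite -(big_mkord xpredT (gammaq P q y ce)).
by apply: nneseries_lim_ge => i _ _; exact: gammaq_ge0.
Qed.

Lemma Gr_ge0 q : 1 <= q -> 0 <= Gr P y ce q.
Proof. by move=> q1; have := sum_gam_le 0 q1; rewrite big_ord0. Qed.

Lemma Mr_ge0 q : 1 <= q -> 0 <= Mr P y q.
Proof. by move=> q1; case: (y_bound 0 q1). Qed.

Lemma measurable_ce k tau a : (tau <= k)%N -> measurable_fun setT (fun w => ce k tau w a 0).
Proof. by move=> /ceP[mc _]; exact: Gmeas_measurable (sFp _).2 (mc a). Qed.

Lemma ce_bound q k tau : 1 <= q -> (tau <= k)%N ->
  Lbound P q (fun w => nrm (fun a => y k w a 0 - ce k tau w a 0)) (gam q tau).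
Proof.
move=> q1 tk.
have h : (LqE P q (fun w => nrm (fun a => y k w a 0 - ce k tau w a 0)%R) <= (gam q tau)%:E)%E.
  have -> : (fun w => nrm (fun a => y k w a 0 - ce k tau w a 0)) =
      (fun w => vnorm (y k w - ce k tau w)).
    apply/funext => w; rewrite /vnorm /nrm; congr Num.sqrt.
    by apply: eq_bigr => a _; rewrite !mxE.
  by rewrite -gam_fin//; apply: ereal_sup_ubound; exists k; first exact: tk.
split => //; [|by move=> w; exact: nrm_ge0|exact: gam_ge0].
by apply: measurable_nrm => a; apply: measurable_funB; [exact: measurable_y|exact: measurable_ce].
Qed.

Lemma rintegrable_y k a : rintegrable P (fun w => y k w a 0).
Proof.
apply: (rintegrable_coord (X := fun w a => y k w a 0)); first by move=> b; exact: measurable_y.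
by have [] := Lbound_Ex (lexx 1) (y_bound k (lexx 1)).
Qed.

Lemma rintegrable_yM k l a b : rintegrable P (fun w => y k w a 0 * y l w b 0).
Proof.
have h2 : 1 <= 2 * 1 :> R by rewrite mulr1 ler1n.
have [h _] := Lbound_Ex (lexx 1) (LboundM ltr01 (y_bound k h2) (y_bound l h2)).
apply: (rintegrable_le _ h); first by apply: measurable_funM; exact: measurable_y.
move=> w; rewrite normrM ler_pM ?normr_ge0//.
  exact: (nrm_coord (fun a => y k w a 0)).
exact: (nrm_coord (fun a => y l w a 0)).
Qed.

Lemma stationary_pair s k l a b A B : measurable A -> measurable B ->
  P ((fun w => y (s + k)%N w a 0) @^-1` A `&` (fun w => y (s + l)%N w b 0) @^-1` B) =
  P ((fun w => y k w a 0) @^-1` A `&` (fun w => y l w b 0) @^-1` B).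
Proof.
move=> mA mB.
pose t (j : 'I_2) := if j == 0 then k else l.
pose C (j : 'I_2) (c : 'I_n) : set R :=
  if j == 0 then (if c == a then A else setT) else (if c == b then B else setT).
have mC j c : measurable (C j c) by rewrite /C; do !case: ifP.
have e (x : nat -> T -> 'cV[R]_n) :
    [set w | forall j c, C j c (x (t j) w c 0)] =
    (fun w => x k w a 0) @^-1` A `&` (fun w => x l w b 0) @^-1` B.
  apply/seteqP; split => w /=.
    by move=> H; split; [have := H 0 a|have := H 1 b]; rewrite /C /t !eqxx.
  move=> [Aw Bw] j c; rewrite /C /t; case: ifP => _; case: ifP => // /eqP ->//.
by have := yS t s mC; rewrite (e (fun m => y (s + m)%N)) (e y).
Qed.

Lemma mean_y k a : Ex P (fun w => y k w a 0) = mu P y a 0.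
Proof.
rewrite mxE.
(* Multiplying by the constant 1 makes the equality in law of pairs applicable to a single
   sample. *)
have e l : Ex P (fun w => y l w a 0) = Ex P (fun w => y l w a 0 * 1).
  by apply: eq_Ex => w; rewrite mulr1.
rewrite (e k) (e 0%N); apply: (eq_Ex_joint (f := fun w => y k w a 0) (g := fun=> 1)
   (f' := fun w => y 0 w a 0) (g' := fun=> 1)).
- move=> A B mA mB; have [B1|B1] := pselect (B 1).
    have -> : (fun=> 1 : R) @^-1` B = setT :> set T by apply/seteqP; split.
    have := stationary_pair k 0 0 a a mA measurableT.
    by rewrite addn0 !preimage_setT.
  have -> : (fun=> 1 : R) @^-1` B = set0 :> set T by apply/seteqP; split.
  by rewrite !setI0.
- by apply: rintegrable_eq (rintegrable_y k a) => w; rewrite mulr1.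
- by apply: rintegrable_eq (rintegrable_y 0 a) => w; rewrite mulr1.
- exact: measurable_y.
- exact: measurable_cst.
- exact: measurable_y.
- exact: measurable_cst.
Qed.

Lemma mean_ce k tau a : (tau <= k)%N -> Ex P (fun w => ce k tau w a 0) = mu P y a 0.
Proof.
move=> tk; rewrite -(mean_y k a); congr fine.
have [_ [_ H]] := ceP tk; apply: H.
have [h0 hC _] := (sFp (k - tau)%N).1.
by have := hC _ h0; rewrite setD0.
Qed.

Lemma cross_moment s k l a b :
  Ex P (fun w => y (s + k)%N w a 0 * y (s + l)%N w b 0) =
  Ex P (fun w => y k w a 0 * y l w b 0).
Proof.
apply: (eq_Ex_joint (f := fun w => y (s + k)%N w a 0) (g := fun w => y (s + l)%N w b 0)
   (f' := fun w => y k w a 0) (g' := fun w => y l w b 0)); try exact: measurable_y.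
- by move=> A B mA mB; exact: stationary_pair.
- exact: rintegrable_yM.
- exact: rintegrable_yM.
Qed.

Definition yc (l : nat) (w : T) (a : 'I_n) : R := y l w a 0 - mu P y a 0.

Lemma yc_bound q k : 1 <= q ->
  Lbound P q (fun w => nrm (yc k w)) (2 * Mr P y q).
Proof.
move=> q1; apply: Lbound_eq (Lbound_center q1 (X := fun w a => y k w a 0) _ (y_bound k q1)).
  by move=> w; apply: eq_nrm => a; rewrite /yc mean_y.
by move=> a; exact: measurable_y.
Qed.

Lemma Gmeas_yc k a : Gmeasurable (F k) (fun w => yc k w a).
Proof. by apply: (GmeasB (sF k).1); [exact: Gmeas_y|exact: (Gmeas_cst (sF k).1)]. Qed.

Lemma vmeas_yc k : vmeas (yc k).
Proof. by move=> a; exact: Gmeas_measurable (sF k).2 (@Gmeas_yc k a). Qed.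

Lemma rintegrable_ce k tau a : (tau <= k)%N -> rintegrable P (fun w => ce k tau w a 0).
Proof. by move=> /ceP[_ [h _]]; exact: h. Qed.

Lemma Gmeas_ce k tau a : (tau <= k)%N -> Gmeasurable (Fp (k - tau)%N) (fun w => ce k tau w a 0).
Proof. by move=> /ceP[h _]; exact: h. Qed.

(** The k-th term is approximated from time s + j on by the conditional expectation with lag k - j,
    and [conv_sum_le] sums the lags. For weights of total square 1 and exponent 2p the bound is [c1]
    at p. *)
Lemma weighted_sum_bound p s N (u v : nat -> R) : 2 <= p ->
  Lbound P p (fun w => nrm (fun ab => \sum_(k < N) cscale (u k) (v k) (yc (s + k)%N w) ab))
    (4 * Num.sqrt ((p - 1) * Mr P y p * Gr P y ce p)
       * Num.sqrt (\sum_(k < N) (u k ^+ 2 + v k ^+ 2))).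
Proof.
move=> p2; have p1 : 1 <= p by apply: le_trans p2; rewrite ler1n.
have p0 : 0 < p by exact: lt_le_trans p1.
pose c k := Num.sqrt (u k ^+ 2 + v k ^+ 2).
have c0 k : 0 <= c k by exact: sqrtr_ge0.
pose X k w := cscale (u k) (v k) (yc (s + k)%N w).
pose Z k j w := cscale (u k) (v k) (fun a => ce (s + k)%N (k - j)%N w a 0 - mu P y a 0).
have le_sk k j : (k - j <= s + k)%N by rewrite (leq_trans (leq_subr _ _))// leq_addl.
have mX k ab : Gmeasurable (F (s + k)%N) (fun w => X k w ab).
  by apply: (GmeasZ (sF _).1); exact: Gmeas_yc.
have mZ k j ab : (j <= k)%N -> Gmeasurable (Fp (s + j)%N) (fun w => Z k j w ab).
  move=> jk; apply: (GmeasZ (sFp _).1); apply: (GmeasB (sFp _).1); last exact: (Gmeas_cst (sFp _).1).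
  have -> : (s + j = s + k - (k - j))%N by lia.
  exact: Gmeas_ce.
have Z0 k j ab : (j <= k)%N -> Ex P (fun w => Z k j w ab) = 0.
  move=> jk; have ic := rintegrable_ce ab.1 (le_sk k j).
  rewrite ExZ; last by apply: rintegrableB => //; exact: rintegrable_cst.
  by rewrite ExB//; [rewrite mean_ce// Ex_cst subrr mulr0|exact: rintegrable_cst].
have XA k : Lbound P p (fun w => nrm (X k w)) (c k * (2 * Mr P y p)).
  apply: Lbound_eq (Lbound_Z p0 (c0 k) (yc_bound (s + k) p1)) => w.
  by rewrite nrm_cscale.
have XZB k j : (j <= k)%N ->
    Lbound P p (fun w => nrm (fun i => X k w i - Z k j w i)) (c k * gam p (k - j)).
  move=> jk; apply: Lbound_eq (Lbound_Z p0 (c0 k) (ce_bound p1 (le_sk k j))) => w.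
  rewrite -nrm_cscale; apply: eq_nrm => ab.
  by rewrite /X /Z /cscale /yc; ring.
have mono j k : (j <= k)%N -> F (s + j) `<=` F (s + k).
  by move=> jk; apply: filtration_mono; rewrite leq_add2l.
have := psum_bound p2 (fun k => sF (s + k)) (fun k => sFp (s + k)) mono
  (fun k => @FFp (s + k)) mX mZ Z0 N XA XZB.
apply: Lbound_widen.
have pm1 : 0 <= p - 1 by rewrite subr_ge0.
have M0 := Mr_ge0 p1; have G0 := Gr_ge0 p1.
rewrite -[4 * _]ger0_norm ?mulr_ge0 ?sqrtr_ge0// -sqrtr_sqr -sqrtrM ?sqr_ge0//.
rewrite ler_wsqrtr// exprMn sqr_sqrtr ?mulr_ge0//.
have -> : \sum_(k < N) (u k ^+ 2 + v k ^+ 2) = \sum_(k < N) c k ^+ 2.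
  by apply: eq_bigr => k _; rewrite sqr_sqrtr// addr_ge0 ?sqr_ge0.
have := conv_sum_le c N (gam_ge0 p) (fun N => sum_gam_le N p1).
set S := \sum_(k < N) c k ^+ 2; set D := \sum_(k < N) _ => DS.
have -> : \sum_(k < N) \sum_(j < k.+1) c j * (2 * Mr P y p) * (c k * gam p (k - j)) =
    2 * Mr P y p * D.
  rewrite mulr_sumr; apply: eq_bigr => k _; rewrite mulr_sumr.
  by apply: eq_bigr => j _; ring.
have -> : 4 ^+ 2 * ((p - 1) * Mr P y p * Gr P y ce p) * S =
  8 * (p - 1) * (2 * Mr P y p * (Gr P y ce p * S)) by ring.
by rewrite !ler_wpM2l ?mulr_ge0.
Qed.

(** * Window transforms and their approximants *)

Section Windows.
Variables (K M : nat) (wr wi : nat -> R).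
Hypotheses (K0 : (0 < K)%N) (KM : (K <= M)%N).
Hypothesis w1 : \sum_(k < M) (wr k ^+ 2 + wi k ^+ 2) = 1.
Variable p : R.
Hypothesis p2 : 2 <= p.

Let q := 2 * p.
Let q2 : 2 <= q. Proof. by rewrite ler_peMr//; apply: le_trans p2; rewrite ler1n. Qed.
Let q1 : 1 <= q. Proof. by apply: le_trans q2; rewrite ler1n. Qed.
Let p1 : 1 <= p. Proof. by apply: le_trans p2; rewrite ler1n. Qed.
Let p0 : 0 < p. Proof. exact: lt_le_trans p1. Qed.
Let q0 : 0 < q. Proof. exact: lt_le_trans q1. Qed.
Let C1 := c1 P y ce p.
Let M0 : (0 < M)%N. Proof. exact: leq_trans KM. Qed.

Lemma c1_ge0 : 0 <= C1. Proof. by rewrite mulr_ge0 ?sqrtr_ge0. Qed.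

Definition zwin j w (ab : 'I_n * bool) : R :=
  \sum_(k < M) cscale (wr k) (wi k) (yc (j * K + k)%N w) ab.

Lemma zwin_bound j : Lbound P q (fun w => nrm (zwin j w)) C1.
Proof.
have := weighted_sum_bound (j * K) M wr wi q2.
by rewrite w1 sqrtr1 mulr1.
Qed.

(** The time of the last sample of window j. Sums over windows use [F] and [Fp] only at these times,
    so that window j is measurable at its own time. *)
Let wend j := (j * K + (M - 1))%N.

(** Samples from the end of window i on are replaced by conditional expectations given the future of
    that time; earlier ones, which occur when the windows overlap, by their mean, that is, by 0
    after centring. *)
Definition zapprox j i w (ab : 'I_n * bool) : R :=
  \sum_(k < M) if (wend i <= j * K + k)%N then
    cscale (wr k) (wi k)
      (fun a => ce (j * K + k) (j * K + k - wend i) w a 0 - mu P y a 0) ab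
  else 0.

(** The first sum collects the conditional expectation errors. The second term pays for the dropped
    samples, present only for t K < M - 1; they form one weighted sum, so a single [C1] bounds them
    together. *)
Definition zerr t : R :=
  \sum_(k < M) (if (M - 1 <= t * K + k)%N then gam q (t * K + k - (M - 1)) else 0)
  + (if (t * K < M - 1)%N then C1 else 0).

Lemma zerr_ge0 t : 0 <= zerr t.
Proof.
rewrite addr_ge0//; last by case: ifP => // _; exact: c1_ge0.
by apply: sumr_ge0 => k _; case: ifP => // _; exact: gam_ge0.
Qed.

(** Each index t K + k is reached at most [Lf] times, which gives Lf Gamma; the condition t K < M -
    1 leaves at most [Lf] values of t, each costing [C1]. *)
Lemma sum_zerr_le N : \sum_(t < N) zerr t <= c2 P M K y ce p.
Proof.
have L0 : 0 <= Lf M K :> R by rewrite ler0n.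
have LC : 0 <= Lf M K * C1 by rewrite mulr_ge0 ?c1_ge0.
rewrite big_split/=; apply: (@le_trans _ _ (Lf M K * Gr P y ce q + Lf M K * C1)).
  2: by rewrite /c2 addrC lerD2r -mulrA ler_peMl// ler1n.
apply: lerD.
  pose G l := if (M - 1 <= l)%N then gam q (l - (M - 1)) else 0.
  have G0 l : 0 <= G l by rewrite /G; case: ifP => // _; exact: gam_ge0.
  apply: (le_trans (window_sum_le N K0 M0 G0)); rewrite ler_wpM2l//.
  by apply: sum_shift_le => [k|N']; [exact: gam_ge0|exact: sum_gam_le].
apply: le_trans (sum_prefix_le ((M - 1) %/ K).+1 N c1_ge0).
apply: ler_sum => t _; have [tK|_] := ltnP (t * K) (M - 1).
  by rewrite ltnS leq_divRL// ltnW.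
by case: ifP => // _; exact: c1_ge0.
Qed.

Lemma weight_le1 (k : 'I_M) : Num.sqrt (wr k ^+ 2 + wi k ^+ 2) <= 1.
Proof.
rewrite -[leRHS]sqrtr1 ler_wsqrtr// -w1 (bigD1 k)//= lerDl.
by apply: sumr_ge0 => j _; rewrite addr_ge0 ?sqr_ge0.
Qed.

Lemma vmeas_cscale u v (x : T -> 'I_n -> R) : vmeas x -> vmeas (fun w => cscale u v (x w)).
Proof. by move=> mx ab; apply: measurable_funM => //; exact: mx. Qed.

Lemma vmeas_sum (I : finType) (x : 'I_M -> T -> I -> R) : (forall k, vmeas (x k)) ->
  vmeas (fun w i => \sum_(k < M) x k w i).
Proof. by move=> mx i; apply: measurable_sum => k; exact: mx. Qed.

Lemma zapprox_bound j i : (i <= j)%N ->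
  Lbound P q (fun w => nrm (fun ab => zwin j w ab - zapprox j i w ab)) (zerr (j - i)).
Proof.
move=> ij.
have fE k : (wend i <= j * K + k)%N = (M - 1 <= (j - i) * K + k)%N.
  by rewrite /wend mulnBl; have : (i * K <= j * K)%N by [rewrite leq_mul2r ij orbT]; lia.
have fE' k : (j * K + k - wend i)%N = ((j - i) * K + k - (M - 1))%N.
  by rewrite /wend mulnBl; have : (i * K <= j * K)%N by [rewrite leq_mul2r ij orbT]; lia.
pose e k w ab := if (wend i <= j * K + k)%N then
    cscale (wr k) (wi k) (fun a => y (j * K + k)%N w a 0 - ce (j * K + k)%N (j * K + k - wend i) w a 0) ab
  else 0.
(* The weights of the dropped samples: a part of [wr] and [wi], so their squares still sum to at
   most 1. *)
pose u k := if (wend i <= j * K + k)%N then 0 else wr k.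
pose v k := if (wend i <= j * K + k)%N then 0 else wi k.
have eb (k : 'I_M) : Lbound P q (fun w => nrm (e k w))
    (if (M - 1 <= (j - i) * K + k)%N then gam q ((j - i) * K + k - (M - 1)) else 0).
  rewrite /e -fE -fE'; case: ifP => _; last first.
    by apply: Lbound_eq (Lbound_cst _ q0 (lexx 0)) => w; rewrite nrm0.
  have := Lbound_Z q0 (sqrtr_ge0 (wr k ^+ 2 + wi k ^+ 2))
    (ce_bound q1 (leq_subr (wend i) (j * K + k))).
  move=> /(Lbound_widen (ler_piMl (gam_ge0 _ _) (weight_le1 k))).
  by apply: Lbound_eq => w; rewrite -nrm_cscale.
have me (k : 'I_M) : vmeas (e k).
  move=> ab; rewrite /e; have [_|_] := leqP (wend i) (j * K + k); last exact: measurable_cst.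
  apply: vmeas_cscale => a; apply: measurable_funB; first exact: measurable_y.
  by apply: measurable_ce; exact: leq_subr.
have e_sum : Lbound P q (fun w => nrm (fun ab => \sum_(k < M) e k w ab))
   (\sum_(k < M) (if (M - 1 <= (j - i) * K + k)%N then gam q ((j - i) * K + k - (M - 1)) else 0)).
  apply: (Lbound_le _ _ _ _ (Lbound_sum (index_enum _) (Q := xpredT) q1 (fun k _ => eb k))) => //.
  - by apply: measurable_nrm; exact: vmeas_sum.
  - by move=> w; exact: nrm_ge0.
  - by move=> w; exact: nrm_sum.
have r_sum : Lbound P q
    (fun w => nrm (fun ab => \sum_(k < M) cscale (u k) (v k) (yc (j * K + k)%N w) ab))
    (if ((j - i) * K < M - 1)%N then C1 else 0).
  have [tK|tK] := ltnP ((j - i) * K) (M - 1); last first.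
    apply: Lbound_eq (Lbound_cst _ q0 (lexx 0)) => w; rewrite -[LHS](@nrm0 R ('I_n * bool)%type).
    apply: eq_nrm => ab; rewrite big1// => k _; rewrite /cscale /u /v fE.
    by rewrite (leq_trans tK (leq_addr _ _)) if_same mul0r.
  have := weighted_sum_bound (j * K) M u v q2; apply: Lbound_widen.
  rewrite ler_piMr ?c1_ge0// -[leRHS]sqrtr1 ler_wsqrtr// -w1.
  apply: ler_sum => k _; rewrite /u /v; case: ifP => // _.
  by rewrite expr0n addr0 addr_ge0 ?sqr_ge0.
have mr : vmeas (fun w ab => \sum_(k < M) cscale (u k) (v k) (yc (j * K + k)%N w) ab).
  by apply: vmeas_sum => k; apply: vmeas_cscale; exact: vmeas_yc.
have := Lbound_nrmD q1 (vmeas_sum me) mr e_sum r_sum.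
apply: Lbound_eq => w; apply: eq_nrm => ab.
rewrite /zwin /zapprox -sumrB -big_split/=; apply: eq_bigr => k _.
rewrite /e /u /v /cscale /yc; case: ifP => _; last by rewrite add0r subr0.
by rewrite if_same mul0r addr0; ring.
Qed.

(** * The centred sum of outer products *)

Lemma Gmeas_outer G (x : T -> 'I_n * bool -> R) : sigma_algebra setT G ->
  (forall ab, Gmeasurable G (fun w => x w ab)) ->
  forall i, Gmeasurable G (fun w => outer (x w) (x w) i).
Proof.
move=> sG mx [[a b] []] /=.
  by apply: (GmeasB sG); apply: (GmeasM sG); exact: mx.
by apply: (GmeasD sG); apply: (GmeasM sG); exact: mx.
Qed.

Lemma Gmeas_zwin j ab : Gmeasurable (F (wend j)) (fun w => zwin j w ab).
Proof.
apply: (Gmeas_sum (sF _).1) => k _; apply: (GmeasZ (sF _).1) => B mB.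
apply: (@filtration_mono (j * K + k)); last exact: Gmeas_yc.
by rewrite /wend leq_add2l; have := ltn_ord k; lia.
Qed.

Lemma Gmeas_zapprox j i ab : Gmeasurable (Fp (wend i)) (fun w => zapprox j i w ab).
Proof.
apply: (Gmeas_sum (sFp _).1) => k _.
have [ik|_] := leqP (wend i) (j * K + k); last exact: (Gmeas_cst (sFp _).1).
apply: (GmeasZ (sFp _).1); apply: (GmeasB (sFp _).1); last exact: (Gmeas_cst (sFp _).1).
have {1}-> : wend i = (j * K + k - (j * K + k - wend i))%N by rewrite subKn.
by apply: Gmeas_ce; exact: leq_subr.
Qed.

Let xx j w := outer (zwin j w) (zwin j w).
(* When the approximation error exceeds [C1], zero is a better approximant. *)
Let aa j i w : 'I_n * 'I_n * bool -> R :=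
  if zerr (j - i) <= C1 then outer (zapprox j i w) (zapprox j i w) else fun=> 0.

Let Gmxx j i : Gmeasurable (F (wend j)) (fun w => xx j w i).
Proof. by apply: (Gmeas_outer (sF _).1); exact: Gmeas_zwin. Qed.

Let Gmaa j i ab : Gmeasurable (Fp (wend i)) (fun w => aa j i w ab).
Proof.
rewrite /aa; have [_|_] := leP (zerr (j - i)) C1; last exact: (Gmeas_cst (sFp _).1).
by apply: (Gmeas_outer (sFp _).1); exact: Gmeas_zapprox.
Qed.

Let mxx j : vmeas (xx j).
Proof. by move=> i; exact: Gmeas_measurable (sF _).2 (Gmxx j i). Qed.

Let maa j i : vmeas (aa j i).
Proof. by move=> ab; exact: Gmeas_measurable (sFp _).2 (Gmaa j i ab). Qed.

Lemma outer_zwin_bound j : Lbound P p (fun w => nrm (outer (zwin j w) (zwin j w))) (C1 * C1).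
Proof.
by apply: Lbound_eq (LboundM p0 (zwin_bound j) (zwin_bound j)) => w; rewrite nrm_outer.
Qed.

(** For zerr <= C1 the sizes of the transform and its approximant add up to at most 2 C1 + zerr <= 3
    C1; otherwise the outer product itself is at most C1^2 <= C1 zerr. Without the case split zerr^2
    would appear, while [sum_zerr_le] controls the first power. *)
Let diff_bound j i : (i <= j)%N ->
  Lbound P p (fun w => nrm (fun ab => xx j w ab - aa j i w ab)) (3 * C1 * zerr (j - i)).
Proof.
move=> ij; have e0 := zerr_ge0 (j - i); have C0 := c1_ge0.
rewrite /aa; have [eC|Ce] := leP (zerr (j - i)) C1; last first.
  apply: (@Lbound_widen _ _ _ _ _ _ (C1 * C1)).
    apply: (@le_trans _ _ (C1 * zerr (j - i))); first by rewrite ler_wpM2l// ltW.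
    by rewrite -(mulrA 3) ler_peMl ?mulr_ge0// ler1n.
  apply: Lbound_eq (outer_zwin_bound j) => w; apply: eq_nrm => ab.
  by rewrite subr0.
have mz : vmeas (zwin j) by move=> ab; exact: Gmeas_measurable (sF _).2 (Gmeas_zwin j ab).
have ma : vmeas (zapprox j i) by move=> ab; exact: Gmeas_measurable (sFp _).2 (Gmeas_zapprox j i ab).
have za := zapprox_bound ij.
have mza : vmeas (fun w ab => zwin j w ab - zapprox j i w ab).
  by move=> ab; exact: measurable_funB.
have ab1 : Lbound P q (fun w => nrm (zapprox j i w)) (C1 + zerr (j - i)).
  apply: Lbound_eq (Lbound_nrmB q1 mz mza (zwin_bound j) za) => w.
  by apply: eq_nrm => ab; rewrite subKr.
have h := LboundM p0 za (LboundD q1 (zwin_bound j) ab1).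
apply: (@Lbound_widen _ _ _ _ _ _ (zerr (j - i) * (C1 + (C1 + zerr (j - i))))).
  rewrite mulrC ler_wpM2r// (_ : 3 * C1 = C1 + (C1 + C1)); last by ring.
  by rewrite !lerD2l.
apply: (Lbound_le p0 _ _ _ h).
- by apply: measurable_nrm => ab; apply: measurable_funB; [exact: mxx|
    exact: Gmeas_measurable (sFp _).2 (Gmeas_outer (sFp _).1 (Gmeas_zapprox j i) ab)].
- by move=> w; exact: nrm_ge0.
- by move=> w; exact: nrm_outerBB.
Qed.

Lemma centered_outer_sum_bound N :
  Lbound P p (fun w => nrm (fun i => \sum_(j < N)
      (outer (zwin j w) (zwin j w) i - Ex P (fun w => outer (zwin j w) (zwin j w) i))))
    (4 * Num.sqrt (6 * (p - 1) * C1 ^+ 3 * c2 P M K y ce p) * Num.sqrt N%:R).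
Proof.
have C0 := c1_ge0.
have ix j := rintegrable_coord (@mxx j) (Lbound_Ex p1 (outer_zwin_bound j)).1.
have ia j i (ij : (i <= j)%N) ab : rintegrable P (fun w => aa j i w ab).
  have mD : vmeas (fun w ab => xx j w ab - aa j i w ab) by move=> c; exact: (measurable_funB (mxx j c) (maa j i c)).
  have := rintegrableB (ix j ab) (rintegrable_coord mD (Lbound_Ex p1 (diff_bound ij)).1 ab).
  by apply: rintegrable_eq => w; rewrite subKr.
pose X j w i := xx j w i - Ex P (fun w => xx j w i).
pose Z j i w ab := aa j i w ab - Ex P (fun w => aa j i w ab).
have mX j i : Gmeasurable (F (wend j)) (fun w => X j w i).
  by apply: (GmeasB (sF _).1) => //; exact: (Gmeas_cst (sF _).1).
have mZ j i ab : (i <= j)%N -> Gmeasurable (Fp (wend i)) (fun w => Z j i w ab).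
  by move=> _; apply: (GmeasB (sFp _).1) => //; exact: (Gmeas_cst (sFp _).1).
have Z0 j i ab : (i <= j)%N -> Ex P (fun w => Z j i w ab) = 0.
  by move=> ij; rewrite ExB; [rewrite Ex_cst subrr|exact: ia|exact: rintegrable_cst].
have XA j : Lbound P p (fun w => nrm (X j w)) (2 * (C1 * C1)).
  exact: Lbound_center (@mxx j) (outer_zwin_bound j).
have XZB j i : (i <= j)%N ->
    Lbound P p (fun w => nrm (fun ab => X j w ab - Z j i w ab)) (6 * C1 * zerr (j - i)).
  move=> ij; have mD : vmeas (fun w ab => xx j w ab - aa j i w ab) by move=> c; exact: (measurable_funB (mxx j c) (maa j i c)).
  rewrite (_ : 6 * C1 * _ = 2 * (3 * C1 * zerr (j - i))); last by ring.
  apply: Lbound_eq (Lbound_center p1 mD (diff_bound ij)) => w; apply: eq_nrm => ab.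
  rewrite ExB; [|exact: ix|exact: ia].
  by rewrite /X /Z; ring.
have mono i j : (i <= j)%N -> F (wend i) `<=` F (wend j).
  by move=> ij; apply: filtration_mono; rewrite /wend leq_add2r leq_mul2r ij orbT.
have := psum_bound p2 (fun k => sF (wend k)) (fun k => sFp (wend k)) mono
  (fun k => @FFp (wend k)) mX mZ Z0 N XA XZB.
apply: Lbound_widen.
have pm1 : 0 <= p - 1 by rewrite subr_ge0.
have S0 : 0 <= c2 P M K y ce p by have := sum_zerr_le 0; rewrite big_ord0.
have pC0 : 0 <= 6 * (p - 1) * C1 ^+ 3 * c2 P M K y ce p.
  by rewrite !mulr_ge0 ?exprn_ge0.
rewrite -[leRHS]ger0_norm ?mulr_ge0 ?sqrtr_ge0// -sqrtr_sqr ler_wsqrtr//.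
rewrite [leRHS]exprMn [X in _ <= X * _]exprMn (sqr_sqrtr pC0) sqr_sqrtr//.
have S1 : \sum_(k < N) 1 ^+ 2 = N%:R :> R.
  by under eq_bigr do rewrite expr1n; rewrite sumr_const card_ord.
have := conv_sum_le (fun=> 1) N zerr_ge0 sum_zerr_le; rewrite S1.
set D := \sum_(k < N) _ => DS.
have -> : \sum_(k < N) \sum_(j < k.+1) 2 * (C1 * C1) * (6 * C1 * zerr (k - j)) =
    12 * C1 ^+ 3 * D.
  rewrite mulr_sumr; apply: eq_bigr => k _; rewrite mulr_sumr.
  by apply: eq_bigr => j _; rewrite mul1r; ring.
have -> : 4 ^+ 2 * (6 * (p - 1) * C1 ^+ 3 * c2 P M K y ce p) * N%:R =
  8 * (p - 1) * (12 * C1 ^+ 3 * (c2 P M K y ce p * N%:R)) by ring.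
by rewrite !ler_wpM2l ?mulr_ge0 ?exprn_ge0.
Qed.

Lemma Ex_ycM s k l a b :
  Ex P (fun w => yc (s + k)%N w a * yc (s + l)%N w b) = Ex P (fun w => yc k w a * yc l w b).
Proof.
have e i j : Ex P (fun w => yc i w a * yc j w b) =
    Ex P (fun w => y i w a 0 * y j w b 0) - mu P y a 0 * mu P y b 0.
  transitivity (Ex P (fun w => y i w a 0 * y j w b 0 - (mu P y b 0 * y i w a 0
     + (mu P y a 0 * y j w b 0 - mu P y a 0 * mu P y b 0)))).
    by apply: eq_Ex => w; rewrite /yc; ring.
  have i1 := rintegrable_yM i j a b.
  have i2 := rintegrableZ (mu P y b 0) (rintegrable_y i a).
  have i3 := rintegrableZ (mu P y a 0) (rintegrable_y j b).
  have i4 := rintegrable_cst P (mu P y a 0 * mu P y b 0).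
  rewrite (ExB i1 (rintegrableD i2 (rintegrableB i3 i4))) (ExD i2 (rintegrableB i3 i4)).
  rewrite (ExB i3 i4) (ExZ _ (rintegrable_y i a)) (ExZ _ (rintegrable_y j b)) Ex_cst !mean_y.
  by ring.
by rewrite !e cross_moment.
Qed.

Lemma rintegrable_ycM k l a b : rintegrable P (fun w => yc k w a * yc l w b).
Proof.
have i1 := rintegrable_yM k l a b.
have i2 := rintegrableZ (mu P y b 0) (rintegrable_y k a).
have i3 := rintegrableZ (mu P y a 0) (rintegrable_y l b).
have i4 := rintegrable_cst P (mu P y a 0 * mu P y b 0).
apply: rintegrable_eq (rintegrableB i1 (rintegrableD i2 (rintegrableB i3 i4))) => w.
by rewrite /yc; ring.
Qed.

(** The entries are quadratic in the samples, so shift invariance of the second moments suffices. *)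
Lemma Ex_outer_zwin j i : Ex P (fun w => outer (zwin j w) (zwin j w) i) =
  Ex P (fun w => outer (zwin 0 w) (zwin 0 w) i).
Proof.
case: i => -[a b] c.
pose cf (c : bool) k l := if c then wi k * wr l - wr k * wi l else wr k * wr l + wi k * wi l.
have e m : Ex P (fun w => outer (zwin m w) (zwin m w) (a, b, c)) =
    \sum_(k < M) \sum_(l < M) cf c k l * Ex P (fun w => yc (m * K + k)%N w a * yc (m * K + l)%N w b).
  transitivity (Ex P (fun w => \sum_(k < M) \sum_(l < M)
      cf c k l * (yc (m * K + k)%N w a * yc (m * K + l)%N w b))).
    apply: eq_Ex => w; rewrite /outer /zwin /cf; case: c.
      rewrite !mulr_suml -sumrB; apply: eq_bigr => k _.
      by rewrite !mulr_sumr -sumrB; apply: eq_bigr => l _; rewrite /cscale/=; ring.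
    rewrite !mulr_suml -big_split; apply: eq_bigr => k _.
    by rewrite !mulr_sumr -big_split; apply: eq_bigr => l _; rewrite /cscale/=; ring.
  have ikl (k l : 'I_M) : rintegrable P (fun w =>
      cf c k l * (yc (m * K + k)%N w a * yc (m * K + l)%N w b)).
    by apply: rintegrableZ; exact: rintegrable_ycM.
  rewrite Ex_sum; last by move=> k _; apply: rintegrable_sum => l _; exact: ikl.
  apply: eq_bigr => k _; rewrite Ex_sum; last by move=> l _; exact: ikl.
  by apply: eq_bigr => l _; rewrite ExZ//; exact: rintegrable_ycM.
rewrite !e; apply: eq_bigr => k _; apply: eq_bigr => l _.
by rewrite !Ex_ycM.
Qed.

(** * The running mean and the plug-in error *)

Definition evec j w (a : 'I_n) : R := muhat M K y j w a 0 - mu P y a 0.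

(** The step sizes 1/(j+1) make [muhat] the plain average of the window means; the factor j keeps
    the identity valid at j = 0. *)
Lemma muhatE j w : j%:R *: muhat M K y j w = \sum_(i < j) ybar M K y i w.
Proof.
elim: j => [|j IH]; first by rewrite scale0r big_ord0.
rewrite big_ord_recr/= -IH /alpha.
by rewrite scalerDr scalerA divff ?pnatr_eq0// scale1r -natr1 scalerDl scale1r -addrA [X in _ + X]addrC subrK.
Qed.

Lemma evecE j w a : (0 < j)%N ->
  evec j w a = (j * M)%:R^-1 * \sum_(l < j * K + M) (cover K M j l)%:R * yc l w a.
Proof.
move=> j0; rewrite -(window_sum K M j (fun l => yc l w a)).
have jN : j%:R != 0 :> R by rewrite pnatr_eq0 -lt0n.
have MN : M%:R != 0 :> R by rewrite pnatr_eq0 -lt0n.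
have := muhatE j w => /(congr1 (fun v : 'cV[R]_n => v a 0)).
rewrite mxE summxE.
under eq_bigr do rewrite /ybar mxE summxE.
rewrite -mulr_sumr => h.
have -> : \sum_(i < j) \sum_(k < M) yc (i * K + k)%N w a =
    \sum_(i < j) \sum_(k < M) y (i * K + k)%N w a 0 - (j * M)%:R * mu P y a 0.
  under eq_bigr do rewrite sumrB sumr_const card_ord.
  by rewrite sumrB sumr_const card_ord -mulrnA mulr_natl mulnC.
rewrite natrM /evec; apply: (mulfI jN); rewrite mulrBr h.
by field; rewrite ?jN ?MN.
Qed.

Lemma vmeas_evec j : vmeas (evec j).
Proof.
case: j => [|j] a.
  rewrite (_ : (fun w => _) = (fun=> - mu P y a 0)); first exact: measurable_cst.
  by apply/funext => w; rewrite /evec/= mxE sub0r.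
rewrite (_ : (fun w => _) = (fun w => (j.+1 * M)%:R^-1 *
    \sum_(l < j.+1 * K + M) (cover K M j.+1 l)%:R * yc l w a)); last first.
  by apply/funext => w; rewrite evecE.
apply: measurable_funM => //; apply: measurable_sum => l.
by apply: measurable_funM => //; exact: vmeas_yc.
Qed.

(** By [evecE] the sample weights are cover / (j M), of total square at most Lf / (j M) by
    [sum_cover_sqr_le]; the imaginary weights are 0. *)
Lemma evec_bound j : (0 < j)%N ->
  Lbound P q (fun w => nrm (evec j w)) (C1 * Num.sqrt (Lf M K / (j * M)%:R)).
Proof.
move=> j0.
have jM0 : 0 < (j * M)%:R :> R by rewrite ltr0n muln_gt0 j0.
pose u l : R := (j * M)%:R^-1 * (cover K M j l)%:R.
have := weighted_sum_bound 0 (j * K + M) u (fun=> 0) q2.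
move=> /(Lbound_widen (c' := C1 * Num.sqrt (Lf M K / (j * M)%:R))) H.
apply: Lbound_eq (H _) => [w|].
  rewrite -[LHS]ger0_norm ?nrm_ge0// -[RHS]ger0_norm ?nrm_ge0// -!sqrtr_sqr.
  congr Num.sqrt; rewrite nrm_pairE nrm_sqr; apply: eq_bigr => a _.
  rewrite evecE// [X in _ + X ^+ 2]big1 ?expr0n ?addr0; last by move=> l _; rewrite /cscale mul0r.
  by congr (_ ^+ 2); rewrite mulr_sumr; apply: eq_bigr => l _; rewrite /cscale/= mulrA.
rewrite ler_wpM2l ?c1_ge0// ler_wsqrtr//.
under eq_bigr do rewrite expr0n addr0 exprMn.
rewrite -mulr_sumr; apply: (le_trans (ler_wpM2l (sqr_ge0 _) (sum_cover_sqr_le _ _ _))) => //.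
rewrite -/(Lf M K) le_eqVlt; apply/orP; left; apply/eqP.
move: (j * M)%:R jM0 (Lf M K : R) => X X0 L.
by field; rewrite gt_eqF.
Qed.

Let hr : R := \sum_(k < M) wr k.
Let hi : R := \sum_(k < M) wi k.

(** The triangle inequality, then Cauchy-Schwarz against the constant vector 1. *)
Lemma sum_weights_le : Num.sqrt (hr ^+ 2 + hi ^+ 2) <= Num.sqrt M%:R.
Proof.
pose wv (k : 'I_M) (b : bool) : R := if b then wi k else wr k.
have -> : Num.sqrt (hr ^+ 2 + hi ^+ 2) = nrm (fun b => \sum_(k < M) wv k b).
  by rewrite /nrm big_bool/= addrC.
apply: (le_trans (nrm_sum _ _ _)).
have -> : \sum_(k < M) nrm (wv k) = dot (fun k => nrm (wv k)) (fun=> 1).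
  by apply: eq_bigr => k _; rewrite mulr1.
apply: (le_trans (dot_le _ _)).
have -> : nrm (fun k => nrm (wv k)) = 1.
  rewrite -[RHS]sqrtr1 -w1; congr Num.sqrt; apply: eq_bigr => k _.
  by rewrite nrm_sqr big_bool/= addrC.
rewrite mul1r /nrm ler_wsqrtr//.
by under eq_bigr do rewrite expr1n; rewrite sumr_const card_ord.
Qed.

Definition dwin j w (ab : 'I_n * bool) : R := zwin j w ab - cscale hr hi (evec j w) ab.

(** At j = 0 the running mean is 0, so its error is -mu, bounded by the moment of [y]. For j >= 1
    the sqrt M from |h| cancels the 1 / sqrt M of [evec_bound]. *)
Let gb j : R := if j is 0%N then Num.sqrt M%:R * Mr P y q
                else C1 * Num.sqrt (Lf M K) / Num.sqrt j%:R.

Let gb_bound j : Lbound P q (fun w => nrm (cscale hr hi (evec j w))) (gb j).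
Proof.
have s0 : 0 <= Num.sqrt (hr ^+ 2 + hi ^+ 2) by exact: sqrtr_ge0.
have S0 : 0 <= Num.sqrt M%:R :> R by exact: sqrtr_ge0.
apply: (@Lbound_eq _ _ _ _ _ (fun w => Num.sqrt (hr ^+ 2 + hi ^+ 2) * nrm (evec j w))).
  by move=> w; rewrite nrm_cscale.
case: j => [|j].
  have m0 : Lbound P q (fun w => nrm (evec 0 w)) (Mr P y q).
    have mv : vmeas (fun w a => y 0%N w a 0) by move=> a; exact: measurable_y.
    have [iy Ey] := Lbound_Ex q1 (y_bound 0 q1).
    apply: (Lbound_widen (le_trans (nrm_Ex_le mv iy) Ey)).
    apply: Lbound_eq (Lbound_cst _ q0 (nrm_ge0 _)) => w.
    rewrite -[RHS]nrmN; apply: eq_nrm => a.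
    by rewrite /evec/= mxE sub0r opprK mean_y.
  apply: Lbound_widen (Lbound_Z q0 s0 m0).
  by rewrite ler_wpM2r ?Mr_ge0// sum_weights_le.
have jp : 0 < j.+1%:R :> R by rewrite ltr0n.
have Mp : 0 < M%:R :> R by rewrite ltr0n.
apply: Lbound_widen (Lbound_Z q0 s0 (evec_bound (ltn0Sn j))).
apply: (le_trans (ler_wpM2r _ sum_weights_le)); first by rewrite mulr_ge0 ?c1_ge0 ?sqrtr_ge0.
rewrite /gb le_eqVlt; apply/orP; left; apply/eqP.
rewrite natrM sqrtrM ?ler0n// sqrtrV ?mulr_ge0 ?ler0n// sqrtrM ?ler0n//.
by field; rewrite !gt_eqF ?sqrtr_gt0.
Qed.

Let vmeas_zwin j : vmeas (zwin j).
Proof. by move=> ab; exact: Gmeas_measurable (sF _).2 (Gmeas_zwin j ab). Qed.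

Let vmeas_g j : vmeas (fun w => cscale hr hi (evec j w)).
Proof. by apply: vmeas_cscale; exact: vmeas_evec. Qed.

Let vmeas_dwin j : vmeas (dwin j).
Proof. by move=> ab; exact: (measurable_funB (vmeas_zwin j ab) (vmeas_g j ab)). Qed.

Lemma vmeas_outer (x : T -> 'I_n * bool -> R) : vmeas x -> vmeas (fun w => outer (x w) (x w)).
Proof.
move=> mx i; apply: (GmeasurableT _).1.
by apply: (Gmeas_outer sigma_algebra_measurable_setT) => ab; exact: (GmeasurableT _).2 (mx ab).
Qed.

Let plugin_bound j : Lbound P p (fun w =>
    nrm (fun i => outer (dwin j w) (dwin j w) i - outer (zwin j w) (zwin j w) i))
  (gb j * (2 * C1 + gb j)).
Proof.
have db : Lbound P q (fun w => nrm (dwin j w)) (C1 + gb j).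
  exact: Lbound_nrmB (zwin_bound j) (gb_bound j).
have h := LboundM p0 (gb_bound j) (LboundD q1 db (zwin_bound j)).
have -> : 2 * C1 + gb j = C1 + gb j + C1 by ring.
apply: (Lbound_le p0 _ _ _ h).
- apply: measurable_nrm => i.
  exact: (measurable_funB (vmeas_outer (vmeas_dwin j) i) (vmeas_outer (vmeas_zwin j) i)).
- by move=> w; exact: nrm_ge0.
move=> w; apply: (le_trans (nrm_outerBB _ _)).
rewrite (@eq_nrm _ _ _ (fun ab => - cscale hr hi (evec j w) ab)) ?nrmN// => ab.
by rewrite /dwin addrAC subrr sub0r.
Qed.

(** The term j = 0 is bounded through sqrt M <= M and gives the part in M. For j >= 1
    [cross_term_le] leaves 3 c1 cc / sqrt j, and summation over j doubles the 3. *)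
Let sum_gb_le k : (0 < k)%N -> \sum_(j < k) gb j * (2 * C1 + gb j) <=
  6 * C1 * cc P M K y ce p * Num.sqrt k%:R
  + (Mr P y q ^+ 2 + 2 * C1 * Mr P y q) * M%:R.
Proof.
move=> k0; have C0 := c1_ge0; have mr0 := Mr_ge0 q1.
have L1 : 1 <= Lf M K :> R by rewrite ler1n.
have sL : Num.sqrt (Lf M K) <= Lf M K :> R.
  have s0 := sqrtr_ge0 (Lf M K : R).
  rewrite -[leRHS]sqr_sqrtr ?(le_trans ler01 L1)// expr2 ler_peMl//.
  by rewrite -[leLHS]sqrtr1 ler_wsqrtr.
have M1 : 1 <= M%:R :> R by rewrite ler1n.
have sM0 : 0 <= Num.sqrt M%:R :> R by exact: sqrtr_ge0.
have sM2 : Num.sqrt M%:R ^+ 2 = M%:R :> R by rewrite sqr_sqrtr.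
have sM : Num.sqrt M%:R <= M%:R :> R.
  rewrite -[leRHS]sM2 expr2 ler_peMl//.
  by rewrite -[leLHS]sqrtr1 ler_wsqrtr.
rewrite -(big_mkord xpredT (fun j => gb j * (2 * C1 + gb j))) big_ltn// addrC.
apply: lerD; last first.
  rewrite /gb; move: (Num.sqrt M%:R) sM0 sM2 sM => S S0 <- SM.
  have -> : S * Mr P y q * (2 * C1 + S * Mr P y q) =
    Mr P y q ^+ 2 * S ^+ 2 + 2 * C1 * Mr P y q * S by ring.
  have -> : (Mr P y q ^+ 2 + 2 * C1 * Mr P y q) * S ^+ 2 =
    Mr P y q ^+ 2 * S ^+ 2 + 2 * C1 * Mr P y q * S ^+ 2 by ring.
  by apply: lerD (lexx _) _; apply: ler_wpM2l SM; rewrite !mulr_ge0.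
apply: (@le_trans _ _ (\sum_(1 <= j < k) 3 * C1 * cc P M K y ce p * (Num.sqrt j%:R)^-1)).
  rewrite big_nat_cond [leRHS]big_nat_cond; apply: ler_sum => -[//|j] _.
  rewrite /gb; set r := (Num.sqrt _)^-1.
  have r0 : 0 <= r by rewrite invr_ge0 sqrtr_ge0.
  have r1 : r <= 1.
    rewrite invf_le1 ?sqrtr_gt0 ?ltr0n// -[leLHS]sqrtr1 ler_wsqrtr// ler1n//.
  by apply: cross_term_le => //; rewrite sqr_sqrtr// (le_trans ler01).
rewrite -mulr_sumr.
have c0 : 0 <= 3 * C1 * cc P M K y ce p by rewrite !mulr_ge0// (le_trans ler01).
apply: (le_trans (ler_wpM2l c0 (sum_inv_sqrt_le _))).
by rewrite le_eqVlt; apply/orP; left; apply/eqP; ring.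
Qed.

Lemma online_bound k : (0 < k)%N ->
  Lbound P p (fun w => nrm (fun i => k%:R^-1 * (\sum_(j < k) outer (dwin j w) (dwin j w) i)
      - Ex P (fun w => outer (zwin 0 w) (zwin 0 w) i)))
   ((4 * Num.sqrt (6 * (p - 1) * C1 ^+ 3 * c2 P M K y ce p)
      + 6 * C1 * cc P M K y ce p + 2 * cc P M K y ce p ^+ 2) / Num.sqrt k%:R
     + (Mr P y q ^+ 2 + 2 * C1 * Mr P y q) * M%:R / k%:R).
Proof.
move=> k0; have kp : 0 < k%:R :> R by rewrite ltr0n.
have ki : 0 <= k%:R^-1 :> R by rewrite invr_ge0 ltW.
have hs := Lbound_sum (index_enum 'I_k) (Q := xpredT) p1 (fun j _ => plugin_bound j).
have h := Lbound_Z p0 ki (LboundD p1 (centered_outer_sum_bound k) hs).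
apply: (@Lbound_widen _ _ _ _ _ _ (k%:R^-1 *
   (4 * Num.sqrt (6 * (p - 1) * C1 ^+ 3 * c2 P M K y ce p) * Num.sqrt k%:R
    + \sum_(j < k) gb j * (2 * C1 + gb j)))).
  apply: (le_trans (ler_wpM2l ki (lerD (lexx _) (sum_gb_le k0)))).
  by apply: rate_regroup; rewrite ?sqrtr_gt0// sqr_sqrtr// ltW.
apply: (Lbound_le p0 _ _ _ h).
- apply: measurable_nrm => i; apply: measurable_funB => //.
  apply: measurable_funM => //; apply: measurable_sum => j.
  exact: (vmeas_outer (vmeas_dwin j) i).
- by move=> w; exact: nrm_ge0.
move=> w.
(* The centred sum subtracts k copies of one matrix, because the mean of the outer product does not
   depend on j. *)
have -> : nrm (fun i => k%:R^-1 * (\sum_(j < k) outer (dwin j w) (dwin j w) i)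
      - Ex P (fun w => outer (zwin 0 w) (zwin 0 w) i)) =
   k%:R^-1 * nrm (fun i => \sum_(j < k)
      (outer (zwin j w) (zwin j w) i - Ex P (fun w => outer (zwin j w) (zwin j w) i))
     + \sum_(j < k) (outer (dwin j w) (dwin j w) i - outer (zwin j w) (zwin j w) i)).
  rewrite -[X in X * _]ger0_norm// -nrmZ; apply: eq_nrm => i.
  rewrite -big_split/=.
  rewrite [in RHS](eq_bigr (fun j : 'I_k => outer (dwin j w) (dwin j w) i
      - Ex P (fun w => outer (zwin 0 w) (zwin 0 w) i))); last first.
    by move=> j _; rewrite Ex_outer_zwin; ring.
  rewrite sumrB sumr_const card_ord mulrBr; congr (_ - _).
  by rewrite -(mulr_natl (Ex _ _)) mulKf// gt_eqF.
rewrite ler_wpM2l//; apply: (le_trans (nrmD _ _)); rewrite lerD2l.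
exact: nrm_sum.
Qed.

End Windows.

End StationaryLMixing.

(** * Translation of the complex estimator into real coordinates *)

Section MatrixCoordinates.
Context {R : realType}.
Implicit Types z : R[i].

Lemma Re_add z z' : complex.Re (z + z') = complex.Re z + complex.Re z'.
Proof. by case: z z' => [? ?] [? ?]. Qed.

Lemma Im_add z z' : complex.Im (z + z') = complex.Im z + complex.Im z'.
Proof. by case: z z' => [? ?] [? ?]. Qed.

Lemma Re_sub z z' : complex.Re (z - z') = complex.Re z - complex.Re z'.
Proof. by case: z z' => [? ?] [? ?]. Qed.

Lemma Im_sub z z' : complex.Im (z - z') = complex.Im z - complex.Im z'.
Proof. by case: z z' => [? ?] [? ?]. Qed.

Lemma Re_mulr z (r : R) : complex.Re (z * r%:C%C) = complex.Re z * r.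
Proof. by case: z => ? ? /=; rewrite mulr0 subr0. Qed.

Lemma Im_mulr z (r : R) : complex.Im (z * r%:C%C) = complex.Im z * r.
Proof. by case: z => ? ? /=; rewrite mulr0 add0r. Qed.

Lemma Re_sum (J : Type) (r : seq J) (f : J -> R[i]) :
  complex.Re (\sum_(j <- r) f j) = \sum_(j <- r) complex.Re (f j).
Proof. exact: (big_morph _ Re_add). Qed.

Lemma Im_sum (J : Type) (r : seq J) (f : J -> R[i]) :
  complex.Im (\sum_(j <- r) f j) = \sum_(j <- r) complex.Im (f j).
Proof. exact: (big_morph _ Im_add). Qed.

Context {n : nat}.

Definition vco (v : 'cV[R[i]]_n) : 'I_n * bool -> R := fun ac =>
  if ac.2 then complex.Im (v ac.1 0) else complex.Re (v ac.1 0).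

Definition mco (A : 'M[R[i]]_n) : 'I_n * 'I_n * bool -> R := fun abc =>
  let: (a, b, c) := abc in
  if c then complex.Im (A a b) else complex.Re (A a b).

Lemma frobE (A : 'M[R[i]]_n) : frob A = nrm (mco A).
Proof.
congr Num.sqrt; rewrite !sum_pairE; apply: eq_bigr => a _; apply: eq_bigr => b _.
by rewrite big_bool/= addrC.
Qed.

Lemma mco_outer (v : 'cV[R[i]]_n) : mco (v *m ctr v) = outer (vco v) (vco v).
Proof.
apply/funext => -[[a b] c]; rewrite /mco /outer /vco/= !mxE big_ord1 !mxE.
by case: c; case: (v a 0) => ra ia; case: (v b 0) => rb ib /=; ring.
Qed.

End MatrixCoordinates.

Section EstimatorCoordinates.
Context {R : realType} {d : measure_display} {T : measurableType d}.
Variables (P : probability T R) (n M K : nat) (y : nat -> T -> 'cV[R]_n).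
Variables (wt : 'I_M -> R -> R[i]) (s : R).

(** The weights are extended by 0 to all natural numbers, since the window estimates index them by
    [nat]. *)
Definition wcoef (f : R[i] -> R) (k : nat) : R :=
  if insub k is Some i then f (wt i s) else 0.

Lemma wcoefE f (k : 'I_M) : wcoef f k = f (wt k s).
Proof. by rewrite /wcoef valK. Qed.

Let wr := wcoef (@complex.Re R).
Let wi := wcoef (@complex.Im R).

Lemma vco_dyhat j w : vco (dyhat K y wt j s w) = dwin P y K M wr wi j w.
Proof.
apply/funext => -[a c]; rewrite /vco /dwin /zwin /evec /cscale /yc /dyhat /yhat /hw/=.
rewrite !mxE summxE !Re_sub !Im_sub !Re_mulr !Im_mulr !Re_sum !Im_sum.
by case: c; rewrite mulr_suml [in RHS]mulr_suml -!sumrB; apply: eq_bigr => k _;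
  rewrite !mxE ?Re_mulr ?Im_mulr /wr /wi wcoefE; ring.
Qed.

Lemma vco_center w : vco (yhat K y wt 0 s w - hw wt s *: toC (mu P y)) =
  zwin P y K M wr wi 0 w.
Proof.
apply/funext => -[a c]; rewrite /vco /zwin /cscale /yc /yhat /hw/=.
rewrite !mxE summxE !Re_sub !Im_sub !Re_mulr !Im_mulr !Re_sum !Im_sum.
by case: c; rewrite mulr_suml -!sumrB; apply: eq_bigr => k _;
  rewrite !mxE ?Re_mulr ?Im_mulr /wr /wi wcoefE; ring.
Qed.

Lemma mco_Phibar i : mco (Phibar P K y wt s) i =
  Ex P (fun w => outer (zwin P y K M wr wi 0 w) (zwin P y K M wr wi 0 w) i).
Proof.
case: i => -[a b] c; rewrite /mco /Phibar mxE.
by case: c; apply: eq_Ex => w; rewrite -vco_center -mco_outer.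
Qed.

(** After multiplication by k the recursion merely adds one outer product. The induction can thus
    start at k = 0 whatever [Phi0] is; the first step size, 1, erases it. *)
Lemma mco_Phihat Phi0 k w i : (0 < k)%N -> mco (Phihat K y wt Phi0 k s w) i =
  k%:R^-1 * \sum_(j < k) outer (dwin P y K M wr wi j w) (dwin P y K M wr wi j w) i.
Proof.
move=> k0; have kN : k%:R != 0 :> R by rewrite pnatr_eq0 -lt0n.
apply: (mulfI kN); rewrite mulVKf//; elim: k {k0 kN} => [|k IH].
  by rewrite mul0r big_ord0.
rewrite big_ord_recr/= -IH -vco_dyhat -mco_outer.
have kN : k.+1%:R != 0 :> R by rewrite pnatr_eq0.
have -> : mco (Phihat K y wt Phi0 k s w + (alpha k)%:C%C *:
    (dyhat K y wt k s w *m ctr (dyhat K y wt k s w) - Phihat K y wt Phi0 k s w)) i =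
    mco (Phihat K y wt Phi0 k s w) i + (alpha k) *
    (mco (dyhat K y wt k s w *m ctr (dyhat K y wt k s w)) i - mco (Phihat K y wt Phi0 k s w) i).
  case: i {IH} => -[a b] c; rewrite /mco !mxE [(alpha k)%:C%C * _]mulrC.
  by rewrite Re_add Im_add Re_mulr Im_mulr Re_sub Im_sub; case: c; rewrite mulrC.
rewrite /alpha mulrDr mulrA divff// mul1r -natr1; ring.
Qed.

End EstimatorCoordinates.

Unset Implicit Arguments.
Set Strict Implicit.

Theorem theorem3 (R : realType) (d : measure_display) (T : measurableType d)
  (P : probability T R) (n M K : nat)
  (y : nat -> T -> 'cV[R]_n)
  (F Fp : nat -> set (set T))
  (ce : nat -> nat -> T -> 'cV[R]_n)
  (wt : 'I_M -> R -> R[i])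
  (Phi0 : R -> T -> 'M[R[i]]_n) :
  (1 <= K)%N -> (K <= M)%N ->
  (forall k, sub_sigma (F k)) -> (forall k, sub_sigma (Fp k)) ->
  (forall k, F k `<=` F k.+1) -> (forall k, Fp k.+1 `<=` Fp k) ->
  (forall k, indep_sigma P (F k) (Fp k)) ->
  (forall k tau, (tau <= k)%N -> condexp_version P (Fp (k - tau)%N) (y k) (ce k tau)) ->
  stationary P y ->
  Lmixing P F y ce ->
  (forall s, \sum_(k < M) (complex.Re (wt k s) ^+ 2 + complex.Im (wt k s) ^+ 2) = 1) ->
  forall (k : nat) (s q : R), (2 <= k)%N -> 1 <= q ->
  (LqE P q (fun w => frob (Phihat K y wt Phi0 k s w - Phibar P K y wt s))
   <= (bq P M K y ce q / Num.sqrt k%:R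
       + (Mr P y (4 * q) ^+ 2 + 2 * c1 P y ce (2 * q) * Mr P y (4 * q)) * M%:R / k%:R)%:E)%E.
Proof.
move=> K1 KM sF sFp FS _ FFp ceP yS yL w1 k s q k2 q1.
have q0 : 0 < q by exact: lt_le_trans q1.
have p2 : 2 <= 2 * q by rewrite ler_peMr.
have w1' : \sum_(k < M) (wcoef wt s (@complex.Re R) k ^+ 2 + wcoef wt s (@complex.Im R) k ^+ 2) = 1.
  by rewrite -[RHS](w1 s); apply: eq_bigr => j _; rewrite !wcoefE.
have k0 : (0 < k)%N by exact: leq_trans k2.
have := online_bound sF sFp FS FFp ceP yS yL K1 KM w1' p2 k0.
have -> : 2 * (2 * q) = 4 * q by ring.
(* The bound just obtained is at exponent 2 q, which on a probability space dominates the L_q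
   norm. *)
have qp : q <= 2 * q by rewrite ler_peMl ?ler1n// ltW.
move=> /(Lbound_mono q0 qp) bound.
have toM := @Lbound_eq _ _ _ _ _ _
  (fun w => frob (Phihat K y wt Phi0 k s w - Phibar P K y wt s)) _ _ bound.
have [|_ _ _ h] := toM; last by rewrite /bq; exact: h.
move=> w; rewrite frobE; apply: eq_nrm => i; rewrite -(@mco_Phihat _ _ _ _ _ _ _ _ _ _ Phi0)// -mco_Phibar.
by case: i => -[a b] c; rewrite /mco !mxE; case: c; rewrite ?Re_sub ?Im_sub.
Qed.
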